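(* Let $(A,\alpha)$ be a system consisting of a nonzero $C^{*}$-algebra $A$ and an automorphism $\alpha$ of $A$. Then the partial-isometric crossed product $A\times_{\alpha}^{\mathrm{piso}}\mathbb{N}$ is not simple.
   Context: $\mathbb{N}=\{0,1,2,\dots\}$ and $\alpha_n:=\alpha^n$ for $n\in\mathbb{Z}$. Partial-isometric crossed product: a partial-isometric representation of $\mathbb{N}$ on a Hilbert space $H$ is a map $V:\mathbb{N}\to B(H)$ such that each $V_n$ is a partial isometry and $V_{n+m}=V_nV_m$ (similarly with values in a multiplier algebra $M(B)$). A covariant partial-isometric representation of $(A,\alpha)$ is a pair $(\pi,V)$ with $\pi$ a nondegenerate representation of $A$ and $V$ a partial-isometric representation of $\mathbb{N}$ such that $\pi(\alpha_n(a))=V_n\pi(a)V_n^*$ and $V_n^*V_n\pi(a)=\pi(a)V_n^*V_n$ for all $a\in A$, $n\in\mathbb{N}$. The partial-isometric crossed product $A\times_{\alpha}^{\mathrm{piso}}\mathbb{N}$ is the (unique up to isomorphism) $C^*$-algebra $B$ with a nondegenerate homomorphism $j_A:A\to B$ and a partial-isometric representation $v:\mathbb{N}\to M(B)$ such that $(j_A,v)$ is covariant, every covariant partial-isometric representation $(\pi,V)$ on a Hilbert space $H$ is of the form $\pi=(\pi\times V)\circ j_A$, $V=\overline{\pi\times V}\circ v$ for a nondegenerate representation $\pi\times V:B\to B(H)$, and $B$ is the closed linear span of $\{v_n^*j_A(a)v_m:n,m\in\mathbb{N},a\in A\}$. A $C^*$-algebra is simple if it has no nontrivial (closed two-sided)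 ideal, i.e. no ideal other than $0$ and itself. *)

(* Defs.v *)
From HB Require Import structures.
From mathcomp Require Import all_boot all_order all_algebra complex.
From mathcomp Require Import all_classical all_reals all_analysis.

Set Implicit Arguments.
Unset Strict Implicit.
Unset Printing Implicit Defensive.

Import Order.TTheory GRing.Theory Num.Theory.
Import numFieldNormedType.Exports.

Local Open Scope classical_set_scope.
Local Open Scope ring_scope.

#[local] Obligation Tactic := idtac.

(* Complex *-algebras, not necessarily unital (MathComp rings are unital, so  *)
(* the product is a separate operation).                                      *)
HB.mixin Record Lmodule_isStarAlgebra (R : realType) A
    of GRing.Lmodule R[i] A := {
  amul : A -> A -> A;
  star : A -> A;
  amulA : associative amul;
  amulDl : left_distributive amul +%R;
  amulDr : right_distributive amul +%R;
  amulZl : forall (c : R[i]) x y, amul (c *: x) y = c *: amul x y;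
  amulZr : forall (c : R[i]) x y, amul x (c *: y) = c *: amul x y;
  starD : {morph star : x y / x + y};
  starZ : forall (c : R[i]) x, star (c *: x) = c^* *: star x;
  starK : involutive star;
  starM : forall x y, star (amul x y) = amul (star y) (star x)
}.

#[short(type="starAlgType")]
HB.structure Definition StarAlgebra (R : realType) :=
  {A of Lmodule_isStarAlgebra R A & GRing.Lmodule R[i] A}.

Notation "x ** y" := (amul x y) (at level 40, left associativity) : ring_scope.

(* The norm of a normed space over R[i] takes its values in R[i], where       *)
(* [x <= y] means that [y - x] is real and nonnegative.                       *)
HB.mixin Record StarAlgebra_isCstar (R : realType) A
    of StarAlgebra R A & CompleteNormedModule R[i] A := {
  cstar_normM : forall x y : A, `|x ** y| <= `|x| * `|y|;
  cstar_identity : forall x : A, `|star x ** x| = `|x| ^+ 2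
}.

#[short(type="cstarType")]
HB.structure Definition CstarAlgebra (R : realType) :=
  {A of StarAlgebra_isCstar R A & StarAlgebra R A &
        CompleteNormedModule R[i] A}.

(* Inner products are linear in the first variable.                           *)
HB.mixin Record CompleteNormedModule_isHilbert (R : realType) H
    of CompleteNormedModule R[i] H := {
  dot : H -> H -> R[i];
  dotDl : forall x y z, dot (x + y) z = dot x z + dot y z;
  dotZl : forall (c : R[i]) x y, dot (c *: x) y = c * dot x y;
  dotC : forall x y, dot x y = (dot y x)^*;
  dot_norm : forall x, dot x x = `|x| ^+ 2
}.

#[short(type="hilbertType")]
HB.structure Definition Hilbert (R : realType) :=
  {H of CompleteNormedModule_isHilbert R H & CompleteNormedModule R[i] H}.

Definition bounded_map (R : realType) (V W : normedModType R[i])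
    (f : V -> W) : Prop :=
  exists2 M : R[i], 0 <= M & forall x, `|f x| <= M * `|x|.

Definition lin_span (R : realType) (V : lmodType R[i]) (S : set V) : set V :=
  [set x | exists (n : nat) (c : 'I_n -> R[i]) (s : 'I_n -> V),
     (forall i, S (s i)) /\ x = \sum_i c i *: s i].

Section BoundedLemmas.
Variable R : realType.
Implicit Types U V W : normedModType R[i].

Lemma bounded_map0 V W : bounded_map (fun _ : V => 0 : W).
Proof. by exists 0 => // x; rewrite normr0 mul0r. Qed.

Lemma bounded_mapD V W (f g : V -> W) :
  bounded_map f -> bounded_map g -> bounded_map (fun x => f x + g x).
Proof.
move=> [M M0 fM] [N N0 gN]; exists (M + N); first exact: addr_ge0.
by move=> x; rewrite mulrDl (le_trans (ler_normD _ _))// lerD.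
Qed.

Lemma bounded_mapZ V W (c : R[i]) (f : V -> W) :
  bounded_map f -> bounded_map (fun x => c *: f x).
Proof.
move=> [M M0 fM]; exists (`|c| * M); first by rewrite mulr_ge0.
by move=> x; rewrite normrZ -mulrA ler_wpM2l.
Qed.

Lemma bounded_map_comp U V W (f : V -> W) (g : U -> V) :
  bounded_map f -> bounded_map g -> bounded_map (f \o g).
Proof.
move=> [M M0 fM] [N N0 gN]; exists (M * N); first exact: mulr_ge0.
by move=> x; rewrite /= (le_trans (fM _))// -mulrA ler_wpM2l.
Qed.

End BoundedLemmas.

Section CstarLemmas.
Variables (R : realType) (A : cstarType R).

Lemma star_norm_le (x : A) : `|x| <= `|star x|.
Proof.
have [->|x0] := eqVneq x 0; first by rewrite normr0.
have x_gt0 : 0 < `|x| by rewrite normr_gt0.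
by rewrite -(ler_pM2r x_gt0) -expr2 -cstar_identity cstar_normM.
Qed.

Lemma star_norm (x : A) : `|star x| = `|x|.
Proof. by apply/eqP; rewrite eq_le star_norm_le -{2}[x]starK star_norm_le. Qed.

End CstarLemmas.

(* B(H): a bounded operator is stored together with its adjoint, which exists *)
(* and is unique, so that [T |-> bop T] is a bijection onto the bounded       *)
(* linear operators of H (injectivity is [boundedop_eq]).                     *)
Record boundedop (R : realType) (H : hilbertType R) := BoundedOp {
  bop : H -> H;
  bop_adj : H -> H;
  bop_linear : linear bop;
  bop_adj_linear : linear bop_adj;
  bop_bounded : bounded_map bop;
  bop_adj_bounded : bounded_map bop_adj;
  bop_adjP : forall x y, dot (bop x) y = dot x (bop_adj y)
}.

Section BoundedOperators.
Variables (R : realType) (H : hilbertType R).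
Implicit Types S T : boundedop H.

Lemma dotDr (x y z : H) : dot x (y + z) = dot x y + dot x z.
Proof. by rewrite dotC dotDl rmorphD/= -!dotC. Qed.

Lemma dotZr (c : R[i]) (x y : H) : dot x (c *: y) = c^* * dot x y.
Proof. by rewrite dotC dotZl rmorphM/= -dotC. Qed.

Lemma dot_inj (y z : H) : (forall x, dot x y = dot x z) -> y = z.
Proof.
move=> yz; apply/eqP; rewrite -subr_eq0 -normr_eq0 -sqrf_eq0 -dot_norm.
by rewrite -scaleN1r dotDr dotZr yz rmorphN rmorph1 mulN1r subrr.
Qed.

Lemma boundedop_eq S T : bop S =1 bop T -> S = T.
Proof.
case: S T => [f f' lf lf' bf bf' ff'] [g g' lg lg' bg bg' gg'] /= fg.
have {}fg : f = g by apply/funext.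
rewrite -{}fg in lg bg gg' *.
have fg' : f' = g'.
  by apply/funext => y; apply: dot_inj => x; rewrite -ff' gg'.
by rewrite -{}fg' in lg' bg' gg' *; congr BoundedOp; exact: Prop_irrelevance.
Qed.

Program Definition bop_zero : boundedop H :=
  @BoundedOp R H (fun=> 0) (fun=> 0) _ _ _ _ _.
Next Obligation. by move=> c x y; rewrite scaler0 addr0. Qed.
Next Obligation. by move=> c x y; rewrite scaler0 addr0. Qed.
Next Obligation. exact: bounded_map0. Qed.
Next Obligation. exact: bounded_map0. Qed.
Next Obligation.
by move=> x y; rewrite -(scale0r (0 : H)) dotZl mul0r dotZr rmorph0 mul0r.
Qed.

Program Definition bop_add S T : boundedop H :=
  @BoundedOp R H (fun x => bop S x + bop T x)
    (fun x => bop_adj S x + bop_adj T x) _ _ _ _ _.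
Next Obligation.
by move=> S T c x y; rewrite !bop_linear scalerDr addrACA.
Qed.
Next Obligation.
by move=> S T c x y; rewrite !bop_adj_linear scalerDr addrACA.
Qed.
Next Obligation. by move=> S T; apply: bounded_mapD; exact: bop_bounded. Qed.
Next Obligation.
by move=> S T; apply: bounded_mapD; exact: bop_adj_bounded.
Qed.
Next Obligation. by move=> S T x y; rewrite dotDl dotDr !bop_adjP. Qed.

Program Definition bop_scale (a : R[i]) T : boundedop H :=
  @BoundedOp R H (fun x => a *: bop T x) (fun x => a^* *: bop_adj T x)
    _ _ _ _ _.
Next Obligation.
by move=> a T c x y; rewrite !bop_linear scalerDr !scalerA mulrC.
Qed.
Next Obligation.
by move=> a T c x y; rewrite !bop_adj_linear scalerDr !scalerA mulrC.
Qed.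
Next Obligation. by move=> a T; apply: bounded_mapZ; exact: bop_bounded. Qed.
Next Obligation.
by move=> a T; apply: bounded_mapZ; exact: bop_adj_bounded.
Qed.
Next Obligation. by move=> a T x y; rewrite dotZl dotZr conjCK bop_adjP. Qed.

Program Definition bop_mul S T : boundedop H :=
  @BoundedOp R H (bop S \o bop T) (bop_adj T \o bop_adj S) _ _ _ _ _.
Next Obligation. by move=> S T c x y; rewrite /= !bop_linear. Qed.
Next Obligation. by move=> S T c x y; rewrite /= !bop_adj_linear. Qed.
Next Obligation.
by move=> S T; apply: bounded_map_comp; exact: bop_bounded.
Qed.
Next Obligation.
by move=> S T; apply: bounded_map_comp; exact: bop_adj_bounded.
Qed.
Next Obligation. by move=> S T x y; rewrite /= !bop_adjP. Qed.

Program Definition bop_star T : boundedop H :=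
  @BoundedOp R H (bop_adj T) (bop T) _ _ _ _ _.
Next Obligation. by move=> T; exact: bop_adj_linear. Qed.
Next Obligation. by move=> T; exact: bop_linear. Qed.
Next Obligation. by move=> T; exact: bop_adj_bounded. Qed.
Next Obligation. by move=> T; exact: bop_bounded. Qed.
Next Obligation. by move=> T x y; rewrite dotC -bop_adjP -dotC. Qed.

HB.instance Definition _ := gen_eqMixin (boundedop H).
HB.instance Definition _ := gen_choiceMixin (boundedop H).

Fact bop_addA : associative bop_add.
Proof. by move=> S T U; apply: boundedop_eq => x /=; rewrite addrA. Qed.
Fact bop_addC : commutative bop_add.
Proof. by move=> S T; apply: boundedop_eq => x /=; rewrite addrC. Qed.
Fact bop_add0 : left_id bop_zero bop_add.
Proof. by move=> T; apply: boundedop_eq => x /=; rewrite add0r. Qed.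
Fact bop_addN : left_inverse bop_zero (bop_scale (-1)) bop_add.
Proof. by move=> T; apply: boundedop_eq => x /=; rewrite scaleN1r addNr. Qed.

HB.instance Definition _ :=
  GRing.isZmodule.Build (boundedop H) bop_addA bop_addC bop_add0 bop_addN.

Fact bop_scaleA a b T : bop_scale a (bop_scale b T) = bop_scale (a * b) T.
Proof. by apply: boundedop_eq => x /=; rewrite scalerA. Qed.
Fact bop_scale1 : left_id 1 bop_scale.
Proof. by move=> T; apply: boundedop_eq => x /=; rewrite scale1r. Qed.
Fact bop_scaleDr : right_distributive bop_scale +%R.
Proof. by move=> a S T; apply: boundedop_eq => x /=; rewrite scalerDr. Qed.
Fact bop_scaleDl T : {morph bop_scale^~ T : a b / a + b}.
Proof. by move=> a b; apply: boundedop_eq => x /=; rewrite scalerDl. Qed.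

HB.instance Definition _ :=
  GRing.Zmodule_isLmodule.Build R[i] (boundedop H)
    bop_scaleA bop_scale1 bop_scaleDr bop_scaleDl.

Fact bop_mulA : associative bop_mul.
Proof. by move=> S T U; apply: boundedop_eq. Qed.
Fact bop_mulDl : left_distributive bop_mul +%R.
Proof. by move=> S T U; apply: boundedop_eq. Qed.
Fact bop_mulDr : right_distributive bop_mul +%R.
Proof.
move=> S T U; apply: boundedop_eq => x /=.
by have := bop_linear S 1 (bop T x) (bop U x); rewrite !scale1r.
Qed.
Fact bop_mulZl (c : R[i]) S T : bop_mul (c *: S) T = c *: bop_mul S T.
Proof. exact: boundedop_eq. Qed.
Fact bop_mulZr (c : R[i]) S T : bop_mul S (c *: T) = c *: bop_mul S T.
Proof.
apply: boundedop_eq => x /=.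
have S0 : bop S 0 = 0.
  by have := bop_linear S (-1) 0 0; rewrite scaler0 addr0 scaleN1r addNr.
by have := bop_linear S c (bop T x) 0; rewrite S0 !addr0.
Qed.
Fact bop_starD : {morph bop_star : S T / S + T}.
Proof. by move=> S T; apply: boundedop_eq. Qed.
Fact bop_starZ (c : R[i]) T : bop_star (c *: T) = c^* *: bop_star T.
Proof. exact: boundedop_eq. Qed.
Fact bop_starK : involutive bop_star.
Proof. by move=> T; apply: boundedop_eq. Qed.
Fact bop_starM S T : bop_star (bop_mul S T) = bop_mul (bop_star T) (bop_star S).
Proof. exact: boundedop_eq. Qed.

HB.instance Definition _ :=
  Lmodule_isStarAlgebra.Build R (boundedop H)
    bop_mulA bop_mulDl bop_mulDr bop_mulZl bop_mulZr
    bop_starD bop_starZ bop_starK bop_starM.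

End BoundedOperators.

(* M(B), as the algebra of double centralizers of B.                          *)
Record multiplier (R : realType) (B : cstarType R) := Multiplier {
  mleft : B -> B;
  mright : B -> B;
  mleft_linear : linear mleft;
  mright_linear : linear mright;
  mleft_bounded : bounded_map mleft;
  mright_bounded : bounded_map mright;
  mleftM : forall x y, mleft (x ** y) = mleft x ** y;
  mrightM : forall x y, mright (x ** y) = x ** mright y;
  mcentral : forall x y, x ** mleft y = mright x ** y
}.

Section Multipliers.
Variables (R : realType) (B : cstarType R).
Implicit Types m n : multiplier B.

Lemma multiplier_eq m n :
  mleft m =1 mleft n -> mright m =1 mright n -> m = n.
Proof.
case: m n => [l r a1 a2 a3 a4 a5 a6 a7] [l' r' b1 b2 b3 b4 b5 b6 b7] /=.
move=> /funext ll' /funext rr'.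
rewrite -{}ll' -{}rr' in b1 b2 b3 b4 b5 b6 b7 *.
by congr Multiplier; exact: Prop_irrelevance.
Qed.

Lemma mul0a (x : B) : 0 ** x = 0.
Proof. by rewrite -{1}(scale0r (0 : B)) amulZl scale0r. Qed.

Lemma mula0 (x : B) : x ** 0 = 0.
Proof. by rewrite -{1}(scale0r (0 : B)) amulZr scale0r. Qed.

Program Definition mzero : multiplier B :=
  @Multiplier R B (fun=> 0) (fun=> 0) _ _ _ _ _ _ _.
Next Obligation. by move=> c x y; rewrite scaler0 addr0. Qed.
Next Obligation. by move=> c x y; rewrite scaler0 addr0. Qed.
Next Obligation. exact: bounded_map0. Qed.
Next Obligation. exact: bounded_map0. Qed.
Next Obligation. by move=> x y; rewrite mul0a. Qed.
Next Obligation. by move=> x y; rewrite mula0. Qed.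
Next Obligation. by move=> x y; rewrite mul0a mula0. Qed.

Program Definition madd m n : multiplier B :=
  @Multiplier R B (fun x => mleft m x + mleft n x)
    (fun x => mright m x + mright n x) _ _ _ _ _ _ _.
Next Obligation.
by move=> m n c x y; rewrite !mleft_linear scalerDr addrACA.
Qed.
Next Obligation.
by move=> m n c x y; rewrite !mright_linear scalerDr addrACA.
Qed.
Next Obligation. by move=> m n; apply: bounded_mapD; exact: mleft_bounded. Qed.
Next Obligation. by move=> m n; apply: bounded_mapD; exact: mright_bounded. Qed.
Next Obligation. by move=> m n x y; rewrite /= !mleftM amulDl. Qed.
Next Obligation. by move=> m n x y; rewrite /= !mrightM amulDr. Qed.
Next Obligation. by move=> m n x y; rewrite /= amulDl amulDr !mcentral. Qed.

Program Definition mscale (a : R[i]) m : multiplier B :=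
  @Multiplier R B (fun x => a *: mleft m x) (fun x => a *: mright m x)
    _ _ _ _ _ _ _.
Next Obligation.
by move=> a m c x y; rewrite !mleft_linear scalerDr !scalerA mulrC.
Qed.
Next Obligation.
by move=> a m c x y; rewrite !mright_linear scalerDr !scalerA mulrC.
Qed.
Next Obligation. by move=> a m; apply: bounded_mapZ; exact: mleft_bounded. Qed.
Next Obligation. by move=> a m; apply: bounded_mapZ; exact: mright_bounded. Qed.
Next Obligation. by move=> a m x y; rewrite /= mleftM amulZl. Qed.
Next Obligation. by move=> a m x y; rewrite /= mrightM amulZr. Qed.
Next Obligation. by move=> a m x y; rewrite /= amulZl amulZr mcentral. Qed.

Program Definition mmul m n : multiplier B :=
  @Multiplier R B (mleft m \o mleft n) (mright n \o mright m) _ _ _ _ _ _ _.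
Next Obligation. by move=> m n c x y; rewrite /= !mleft_linear. Qed.
Next Obligation. by move=> m n c x y; rewrite /= !mright_linear. Qed.
Next Obligation.
by move=> m n; apply: bounded_map_comp; exact: mleft_bounded.
Qed.
Next Obligation.
by move=> m n; apply: bounded_map_comp; exact: mright_bounded.
Qed.
Next Obligation. by move=> m n x y; rewrite /= !mleftM. Qed.
Next Obligation. by move=> m n x y; rewrite /= !mrightM. Qed.
Next Obligation. by move=> m n x y; rewrite /= !mcentral. Qed.

Lemma bounded_map_star (f : B -> B) :
  bounded_map f -> bounded_map (fun x => star (f (star x))).
Proof.
by move=> [M M0 fM]; exists M => // x; rewrite star_norm -(star_norm x).
Qed.

Program Definition mstar m : multiplier B :=
  @Multiplier R B (fun x => star (mright m (star x)))
    (fun x => star (mleft m (star x))) _ _ _ _ _ _ _.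
Next Obligation.
by move=> m c x y; rewrite !(starD, starZ) mright_linear !(starD, starZ) conjCK.
Qed.
Next Obligation.
by move=> m c x y; rewrite !(starD, starZ) mleft_linear !(starD, starZ) conjCK.
Qed.
Next Obligation.
by move=> m; apply: bounded_map_star; exact: mright_bounded.
Qed.
Next Obligation.
by move=> m; apply: bounded_map_star; exact: mleft_bounded.
Qed.
Next Obligation. by move=> m x y; rewrite /= starM mrightM starM starK. Qed.
Next Obligation. by move=> m x y; rewrite /= starM mleftM starM starK. Qed.
Next Obligation.
by move=> m x y; rewrite /= -{1}[x]starK -starM -mcentral starM starK.
Qed.

HB.instance Definition _ := gen_eqMixin (multiplier B).
HB.instance Definition _ := gen_choiceMixin (multiplier B).

Fact maddA : associative madd.
Proof. by move=> *; apply: multiplier_eq => x /=; rewrite addrA. Qed.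
Fact maddC : commutative madd.
Proof. by move=> *; apply: multiplier_eq => x /=; rewrite addrC. Qed.
Fact madd0 : left_id mzero madd.
Proof. by move=> *; apply: multiplier_eq => x /=; rewrite add0r. Qed.
Fact maddN : left_inverse mzero (mscale (-1)) madd.
Proof. by move=> *; apply: multiplier_eq => x /=; rewrite scaleN1r addNr. Qed.

HB.instance Definition _ :=
  GRing.isZmodule.Build (multiplier B) maddA maddC madd0 maddN.

Fact mscaleA a b m : mscale a (mscale b m) = mscale (a * b) m.
Proof. by apply: multiplier_eq => x /=; rewrite scalerA. Qed.
Fact mscale1 : left_id 1 mscale.
Proof. by move=> *; apply: multiplier_eq => x /=; rewrite scale1r. Qed.
Fact mscaleDr : right_distributive mscale +%R.
Proof. by move=> *; apply: multiplier_eq => x /=; rewrite scalerDr. Qed.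
Fact mscaleDl m : {morph mscale^~ m : a b / a + b}.
Proof. by move=> *; apply: multiplier_eq => x /=; rewrite scalerDl. Qed.

HB.instance Definition _ :=
  GRing.Zmodule_isLmodule.Build R[i] (multiplier B)
    mscaleA mscale1 mscaleDr mscaleDl.

Fact linear_addZ (f : B -> B) : linear f ->
  {morph f : x y / x + y} * (forall (c : R[i]) x, f (c *: x) = c *: f x).
Proof.
move=> lf; split=> [x y|c x]; first by have := lf 1 x y; rewrite !scale1r.
have f0 : f 0 = 0 by have := lf (-1) 0 0; rewrite scaler0 addr0 scaleN1r addNr.
by have := lf c x 0; rewrite f0 !addr0.
Qed.

Fact mmulA : associative mmul.
Proof. by move=> *; apply: multiplier_eq. Qed.
Fact mmulDl : left_distributive mmul +%R.
Proof.
move=> m n p; apply: multiplier_eq => x //=.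
by rewrite (linear_addZ (@mright_linear _ _ p)).
Qed.
Fact mmulDr : right_distributive mmul +%R.
Proof.
move=> m n p; apply: multiplier_eq => x //=.
by rewrite (linear_addZ (@mleft_linear _ _ m)).
Qed.
Fact mmulZl (c : R[i]) m n : mmul (c *: m) n = c *: mmul m n.
Proof.
apply: multiplier_eq => x //=.
by rewrite (linear_addZ (@mright_linear _ _ n)).
Qed.
Fact mmulZr (c : R[i]) m n : mmul m (c *: n) = c *: mmul m n.
Proof.
apply: multiplier_eq => x //=.
by rewrite (linear_addZ (@mleft_linear _ _ m)).
Qed.
Fact mstarD : {morph mstar : m n / m + n}.
Proof. by move=> m n; apply: multiplier_eq => x /=; rewrite starD. Qed.
Fact mstarZ (c : R[i]) m : mstar (c *: m) = c^* *: mstar m.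
Proof. by apply: multiplier_eq => x /=; rewrite starZ. Qed.
Fact mstarK : involutive mstar.
Proof. by move=> m; apply: multiplier_eq => x /=; rewrite !starK. Qed.
Fact mstarM m n : mstar (mmul m n) = mmul (mstar n) (mstar m).
Proof. by apply: multiplier_eq => x /=; rewrite starK. Qed.

HB.instance Definition _ :=
  Lmodule_isStarAlgebra.Build R (multiplier B)
    mmulA mmulDl mmulDr mmulZl mmulZr mstarD mstarZ mstarK mstarM.

Program Definition mult_embed (b : B) : multiplier B :=
  @Multiplier R B (fun x => b ** x) (fun x => x ** b) _ _ _ _ _ _ _.
Next Obligation. by move=> b c x y; rewrite amulDr amulZr. Qed.
Next Obligation. by move=> b c x y; rewrite amulDl amulZl. Qed.
Next Obligation. by move=> b; exists `|b| => // x; exact: cstar_normM. Qed.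
Next Obligation.
by move=> b; exists `|b| => // x; rewrite mulrC; exact: cstar_normM.
Qed.
Next Obligation. by move=> b x y; rewrite /= amulA. Qed.
Next Obligation. by move=> b x y; rewrite /= amulA. Qed.
Next Obligation. by move=> b x y; rewrite /= amulA. Qed.

End Multipliers.

Section CrossedProduct.
Variable R : realType.

Record is_starhom (S T : starAlgType R) (f : S -> T) : Prop := IsStarhom {
  starhom_linear : linear f;
  starhomM : forall x y, f (x ** y) = f x ** f y;
  starhom_star : forall x, f (star x) = star (f x)
}.

Definition is_automorphism (A : starAlgType R) (alpha : A -> A) : Prop :=
  is_starhom alpha /\ bijective alpha.

Definition nondegenerate_hom (A B : cstarType R) (f : A -> B) : Prop :=
  is_starhom f /\
  closure (lin_span [set f a ** b | a in [set: A] & b in [set: B]]) = setT.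

Definition nondegenerate_rep (A : cstarType R) (H : hilbertType R)
    (pi : A -> boundedop H) : Prop :=
  is_starhom pi /\
  closure (lin_span [set bop (pi a) h | a in [set: A] & h in [set: H]]) = setT.

Definition partial_isometry (T : starAlgType R) (w : T) : Prop :=
  w ** star w ** w = w.

Definition piso_representation (T : starAlgType R) (V : nat -> T) : Prop :=
  (forall n, partial_isometry (V n)) /\
  (forall n m, V (n + m)%N = V n ** V m).

Definition covariance (A T : starAlgType R) (alpha : A -> A)
    (pi : A -> T) (V : nat -> T) : Prop :=
  forall (a : A) (n : nat),
    pi (iter n alpha a) = V n ** pi a ** star (V n) /\
    star (V n) ** V n ** pi a = pi a ** (star (V n) ** V n).

Definition covariant_rep (A : cstarType R) (alpha : A -> A)
    (H : hilbertType R) (pi : A -> boundedop H) (V : nat -> boundedop H) :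
    Prop :=
  [/\ nondegenerate_rep pi, piso_representation V & covariance alpha pi V].

(* [rhobar] is the extension of [rho] to M(B); it exists and is unique when   *)
(* [rho] is nondegenerate.                                                    *)
Definition extends_to_multipliers (B : cstarType R) (H : hilbertType R)
    (rho : B -> boundedop H) (rhobar : multiplier B -> boundedop H) : Prop :=
  is_starhom rhobar /\ forall b, rhobar (mult_embed b) = rho b.

Record is_piso_crossed_product (A : cstarType R) (alpha : A -> A)
    (B : cstarType R) (jA : A -> B) (v : nat -> multiplier B) : Prop :=
  IsPisoCrossedProduct {
  piso_cp_nondegenerate : nondegenerate_hom jA;
  piso_cp_representation : piso_representation v;
  piso_cp_covariant : covariance alpha (fun a => mult_embed (jA a)) v;
  piso_cp_universal :
    forall (H : hilbertType R) (pi : A -> boundedop H)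
      (V : nat -> boundedop H),
    covariant_rep alpha pi V ->
    exists (rho : B -> boundedop H) (rhobar : multiplier B -> boundedop H),
      [/\ nondegenerate_rep rho,
          extends_to_multipliers rho rhobar,
          forall a, pi a = rho (jA a)
        & forall n, V n = rhobar (v n)];
  piso_cp_span :
    closure (lin_span [set b : B | exists (n m : nat) (a : A),
      mult_embed b = star (v n) ** mult_embed (jA a) ** v m]) = setT
}.

Record is_closed_ideal (B : cstarType R) (I : set B) : Prop :=
  IsClosedIdeal {
  ideal_closed : closed I;
  ideal0 : I 0;
  idealD : forall x y, I x -> I y -> I (x + y);
  idealZ : forall (c : R[i]) x, I x -> I (c *: x);
  idealMl : forall x y, I y -> I (x ** y);
  idealMr : forall x y, I x -> I (x ** y)
}.

Definition simple_cstar (B : cstarType R) : Prop :=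
  forall I : set B, is_closed_ideal I -> I = [set 0] \/ I = [set: B].

End CrossedProduct.

(* Main.v *)
(* If [B] were simple, every nonzero representation of [B] would be faithful, *)
(* because the kernel of a representation is a closed ideal. Start from a     *)
(* positive functional [phi] on [A], and let [H(I)] be the completion of the  *)
(* finitely supported functions [I -> A] for the form                         *)
(* [sum_i phi (star (h i) ** f i)]. On [H(int)] and on [H(nat)], [A] acts in  *)
(* the [i]-th summand through [alpha^i], and the backward shift [V] completes *)
(* this action to a covariant representation. The shift of [H(int)] is        *)
(* unitary, so the corresponding representation of [B] kills                  *)
(* [jA a - star (v 1) ** v 1 ** jA a] although it is nonzero; on [H(nat)] the *)
(* same element is [jA a] times the projection on the summand [0], which is   *)
(* nonzero for a suitable [a].                                                *)
(*                                                                            *)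
(* Functionals on [A] come from the Hahn-Banach theorem in the multiplier     *)
(* algebra, which serves as a unital C*-algebra containing [A]. There, an     *)
(* element [a = star a] is positive if [|t - a| <= t] for some real [t >= 0]; *)
(* square roots come from a contraction argument, and Kaplansky's argument    *)
(* shows that [star x ** x] is positive, without any spectral theory.         *)

From HB Require Import structures.
Require Import Defs.
From mathcomp Require Import all_boot all_order all_algebra complex.
From mathcomp Require Import all_classical all_reals all_analysis.
From mathcomp Require Import ring lra.

Set Implicit Arguments.
Unset Strict Implicit.
Unset Printing Implicit Defensive.

Import Order.TTheory GRing.Theory Num.Theory.
Import numFieldNormedType.Exports.

Local Open Scope classical_set_scope.
Local Open Scope ring_scope.

Local Notation "r %:C" := (real_complex _ r) : ring_scope.

(** The obstruction to simplicity is the failure of [v 1] to be an isometry. The multiplier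
    [1 - star (v 1) ** v 1] carries [jA a] to an element [d] of [B], and a representation of [B] in
    which the image of [v 1] is isometric kills [d]. Two covariant representations are compared: one
    has a unitary shift, and its [rho1] kills [d] but not [jA a]; the other has a shift with a
    kernel, and its [rho2] does not kill [d]. Hence the kernel of [rho1] contains the nonzero [d]
    and omits [jA a].

    Both are instances of one construction over an index type with a successor and a partial
    predecessor, [shift_covariant_rep]. Over the integers every index has a predecessor and
    [shift_unitary] applies; over the naturals [0] has none and [shift_not_isometric] applies. The
    universal property enters through [crossed_product_rep]; the kernel is closed because star
    homomorphisms into bounded operators are contractive ([star_rep_contractive],
    [kernel_closed_ideal]).

    From [A] the construction takes a positive functional that does not vanish on some
    [star (a ** x) ** (a ** x)] ([nonzero_state]) and an [approximate_unit], which makes the action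
    nondegenerate. Both come from the multiplier algebra, made into a unital C*-algebra:
    [cstar_sqrt] leads to [pos_star_mul], and [hahn_banach] to [unital_real_state], where a
    functional dominated by the norm with value one at the unit is positive. The Hilbert space is
    [hcompl], on which adjointable maps act by [hlift]. *)

Ltac zmod_cancel x t :=
  lazymatch x with
  | ?y + ?b =>
      first
        [ lazymatch t with - ?u => unify u b; rewrite (addrK u y) end
        | lazymatch b with - ?u => unify u t; rewrite (subrK u y) end
        | try rewrite (addrAC y b t); zmod_cancel y t ]
  | _ =>
      first
        [ lazymatch t with - ?u => unify u x; rewrite (subrr u) end
        | lazymatch x with - ?u => unify u t; rewrite (addNr u) end ]
  end.

Ltac zmod_loop :=
  lazymatch goal with
  | |- is_true (0 == 0) => exact: eqxx
  | |- is_true (?x + ?t == 0) => zmod_cancel x t; rewrite ?add0r; zmod_loop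
  end.

(* Identities of abelian groups, by pairwise cancellation of opposite terms. *)
Ltac zmod :=
  apply/eqP; rewrite -subr_eq0
    ?(opprD, opprB, opprK, oppr0, addrA, addr0, sub0r, add0r);
  zmod_loop.

(** * Norms and limits *)

Section RealNorm.
Variable R : realType.

(* Norms over [R[i]] are real numbers of [R[i]], whose order is only partial. *)
Definition nrm (V : normedZmodType R[i]) (x : V) : R := complex.Re `|x|.

Variable V : normedZmodType R[i].
Implicit Types x y z : V.

Lemma nrmE x : (nrm x)%:C = `|x|.
Proof. by rewrite RRe_real// ger0_real. Qed.

Lemma nrm_ge0 x : 0 <= nrm x.
Proof. by rewrite -ler0c nrmE. Qed.

Lemma le_nrm x (r : R) : (nrm x <= r) = (`|x| <= r%:C).
Proof. by rewrite -nrmE lecR. Qed.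

Lemma nrmD x y : nrm (x + y) <= nrm x + nrm y.
Proof. by rewrite le_nrm rmorphD /= !nrmE ler_normD. Qed.

Lemma nrmN x : nrm (- x) = nrm x.
Proof. by rewrite /nrm normrN. Qed.

Lemma nrmBC x y : nrm (x - y) = nrm (y - x).
Proof. by rewrite -nrmN opprB. Qed.

Lemma nrmB x y : nrm (x - y) <= nrm x + nrm y.
Proof. by rewrite -(nrmN y) nrmD. Qed.

Lemma nrm0 : nrm (0 : V) = 0.
Proof. by apply: complexI; rewrite nrmE normr0. Qed.

Lemma nrm_eq0 x : (nrm x == 0) = (x == 0).
Proof. by rewrite -(inj_eq (@complexI R)) nrmE rmorph0 normr_eq0. Qed.

Lemma nrm0_eq0 x : nrm x <= 0 -> x = 0.
Proof. by move=> x0; apply/eqP; rewrite -nrm_eq0 eq_le x0 nrm_ge0. Qed.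

Lemma nrm_tri x y z : nrm (x - z) <= nrm (x - y) + nrm (y - z).
Proof. by rewrite -[x - z](subrKA y) nrmD. Qed.

Lemma nrm_triD x y : nrm x <= nrm y + nrm (x - y).
Proof. by rewrite -{1}(subrK y x) addrC nrmD. Qed.

End RealNorm.

Section RealNormComplex.
Variable R : realType.
Implicit Types c d : R[i].

Lemma nrmr (r : R) : nrm (r%:C : R[i]) = `|r|.
Proof.
by rewrite /nrm normc_def /= expr0n addr0 sqrtr_sqr.
Qed.

Lemma nrmM c d : nrm (c * d) = nrm c * nrm d.
Proof. by apply: complexI; rewrite rmorphM /= !nrmE normrM. Qed.

Lemma nrm_conj c : nrm (c^*) = nrm c.
Proof. by apply: complexI; rewrite !nrmE norm_conjC. Qed.

Lemma nrmZ (V : normedModType R[i]) c (x : V) : nrm (c *: x) = nrm c * nrm x.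
Proof. by apply: complexI; rewrite rmorphM /= !nrmE normrZ. Qed.

Lemma conj_real (r : R) : (r%:C : R[i])^* = r%:C.
Proof. by apply/CrealP/complex_realP; exists r. Qed.

Lemma Re_le_nrm c : `|complex.Re c| <= nrm c.
Proof. by rewrite -lecR nrmE normc_ge_Re. Qed.

Lemma Im_le_nrm c : `|complex.Im c| <= nrm c.
Proof.
case: c => a b /=; rewrite /nrm normc_def /= -(sqrtr_sqr b) ler_wsqrtr//.
by rewrite lerDr sqr_ge0.
Qed.

Lemma nrm_le_ReIm c : nrm c <= `|complex.Re c| + `|complex.Im c|.
Proof.
case: c => a b /=; rewrite /nrm normc_def /= -[leRHS]ger0_norm ?addr_ge0//.
rewrite -sqrtr_sqr ler_wsqrtr// sqrrD !real_normK ?num_real//.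
by rewrite [in leRHS]addrAC lerDl mulrn_wge0// mulr_ge0.
Qed.

End RealNormComplex.

Section Sequences.
Variable R : realType.
Implicit Type V : normedZmodType R[i].

(** Tolerances are real and measured by [nrm], so that estimates take place in the totally ordered
    [R] and not in [R[i]]. *)
Definition tends V (u : nat -> V) (l : V) : Prop :=
  forall e : R, 0 < e ->
    exists N, forall n, (N <= n)%N -> nrm (u n - l) <= e.

Definition cauchy_seq V (u : nat -> V) : Prop :=
  forall e : R, 0 < e -> exists N, forall m n,
    (N <= m)%N -> (N <= n)%N -> nrm (u m - u n) <= e.

Lemma le_epsP (a b C : R) :
  (forall e, 0 < e -> e <= 1 -> a <= b + C * e) -> a <= b.
Proof.
move=> H; rewrite leNgt; apply/negP => ba.
(* This [d] makes [C * d] at most half of the gap [a - b]; the [+ 1] covers [C = 0]. *)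
set d := Num.min 1 ((a - b) / (2 * (`|C| + 1))).
have C0 : 0 < `|C| + 1 by rewrite ltr_wpDl.
have d0 : 0 < d by rewrite lt_min ltr01 divr_gt0 ?subr_gt0// mulr_gt0.
have d1 : d <= 1 by rewrite ge_min lexx.
have := H d d0 d1; rewrite leNgt => /negP; apply.
have dl : (`|C| + 1) * d <= (a - b) / 2.
  have : d <= (a - b) / (2 * (`|C| + 1)) by rewrite ge_min lexx orbT.
  rewrite -(ler_pM2l C0) => h; apply: (le_trans h).
  by rewrite le_eqVlt; apply/orP; left; apply/eqP; field; rewrite gt_eqF.
have : C * d <= `|C| * d by apply: ler_wpM2r; [exact: ltW | exact: ler_norm].
by nra.
Qed.

Lemma le_eps0 (a b : R) : (forall e, 0 < e -> a <= b + e) -> a <= b.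
Proof. by move=> H; apply: (@le_epsP _ _ 1) => e e0 _; rewrite mul1r H. Qed.

Lemma tends_uniq V (u : nat -> V) l l' : tends u l -> tends u l' -> l = l'.
Proof.
move=> ul ul'; apply/eqP; rewrite -subr_eq0; apply/eqP/nrm0_eq0.
apply: (@le_epsP _ _ 2) => e e0 _; rewrite add0r.
have [N uN] := ul e e0; have [M uM] := ul' e e0.
have := nrm_tri l (u (maxn N M)) l'; rewrite (nrmBC l (u _)).
have := uN _ (leq_maxl N M); have := uM _ (leq_maxr N M).
by lra.
Qed.

Lemma tends_uniq_ext V (u v : nat -> V) l l' :
  u =1 v -> tends u l -> tends v l' -> l = l'.
Proof. by move=> /funext ->; exact: tends_uniq. Qed.

Lemma tends_cst V (l : V) : tends (fun=> l) l.
Proof. by move=> e e0; exists 0%N => n _; rewrite subrr nrm0 ltW. Qed.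

Lemma tendsD V (u v : nat -> V) l m :
  tends u l -> tends v m -> tends (fun n => u n + v n) (l + m).
Proof.
move=> ul vm e e0; have e20 : 0 < e / 2 by lra.
have [N uN] := ul _ e20; have [M vM] := vm _ e20.
exists (maxn N M) => n; rewrite geq_max => /andP[/uN Nn /vM Mn].
by rewrite opprD addrACA (le_trans (nrmD _ _))//; lra.
Qed.

Lemma tends_bounded_map V (W : normedZmodType R[i]) (f : V -> W) (C : R) u l :
  (forall x, nrm (f x - f l) <= C * nrm (x - l)) ->
  tends u l -> tends (f \o u) (f l).
Proof.
move=> fC ul e e0; have C0 : 0 < `|C| + 1 by rewrite ltr_wpDl.
have [|N uN] := ul (e / (`|C| + 1)); first by rewrite divr_gt0.
exists N => n /uN; rewrite ler_pdivlMr// => h; apply: le_trans h.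
rewrite (le_trans (fC _))// mulrC ler_wpM2l ?nrm_ge0//.
by rewrite (le_trans (ler_norm _))// lerDl.
Qed.

Lemma tends_le V (u : nat -> V) l (r : R) N :
  tends u l -> (forall n, (N <= n)%N -> nrm (u n) <= r) -> nrm l <= r.
Proof.
move=> ul ur; apply: le_eps0 => e /ul[M /(_ (maxn N M) (leq_maxr N M))].
have := nrm_triD l (u (maxn N M)); rewrite (nrmBC l).
by have := ur _ (leq_maxl N M); lra.
Qed.

Lemma cauchy_seq_le V (W : normedZmodType R[i]) (C : R) (u : nat -> V)
    (v : nat -> W) :
  (forall m n, nrm (v m - v n) <= C * nrm (u m - u n)) ->
  cauchy_seq u -> cauchy_seq v.
Proof.
move=> vC cu e e0; have C0 : 0 < `|C| + 1 by rewrite ltr_wpDl.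
have [|N uN] := cu (e / (`|C| + 1)); first by rewrite divr_gt0.
exists N => m n Nm Nn; have := uN m n Nm Nn.
rewrite ler_pdivlMr// => h; apply: le_trans h.
rewrite (le_trans (vC _ _))// mulrC ler_wpM2l ?nrm_ge0//.
by rewrite (le_trans (ler_norm _))// lerDl.
Qed.

Lemma cauchy_bounded V (u : nat -> V) :
  cauchy_seq u -> exists2 M : R, 0 <= M & forall n, nrm (u n) <= M.
Proof.
move=> /(_ 1 ltr01)[N uN]; exists (nrm (u N) + 1 + \sum_(i < N) nrm (u i)).
  by rewrite addr_ge0 ?sumr_ge0 ?addr_ge0 ?nrm_ge0// => *; rewrite nrm_ge0.
move=> n; have S0 (P : pred 'I_N) : 0 <= \sum_(i < N | P i) nrm (u i).
  by apply: sumr_ge0 => *; rewrite nrm_ge0.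
have [nN|Nn] := ltnP n N.
  rewrite (bigD1 (Ordinal nN))//= addrCA lerDl addr_ge0 ?addr_ge0 ?nrm_ge0//.
have := uN n N Nn (leqnn N); have := nrm_triD (u n) (u N).
by have := S0 xpredT; lra.
Qed.

Lemma cauchy_seq_expr V (u : nat -> V) (k C : R) : 0 <= k -> k < 1 ->
  (forall n m, nrm (u (n + m)%N - u n) <= C * k ^+ n) -> cauchy_seq u.
Proof.
move=> k0 k1 uk e e0.
have C0 : 0 < `|C| + 1 by rewrite ltr_wpDl.
have kn : k ^+ n @[n --> \oo] --> 0 by apply: cvg_expr; rewrite ger0_norm.
have e'0 : 0 < e / (2 * (`|C| + 1)) by rewrite divr_gt0// mulr_gt0.
move/cvgrPdist_le/(_ _ e'0): kn => [N _ /(_ N (leqnn N))/=].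
rewrite add0r normrN ger0_norm ?exprn_ge0// ler_pdivlMr ?mulr_gt0// => kN.
have uN m : (N <= m)%N -> nrm (u m - u N) <= e / 2.
  move=> /subnKC <-; rewrite (le_trans (uk _ _))//.
  have : C * k ^+ N <= (`|C| + 1) * k ^+ N.
    by rewrite ler_wpM2r ?exprn_ge0// (le_trans (ler_norm _))// lerDl.
  by lra.
exists N => m n Nm Nn; have := nrm_tri (u m) (u N) (u n); rewrite (nrmBC (u N)).
by have := uN _ Nm; have := uN _ Nn; lra.
Qed.

End Sequences.

Section Completeness.
Variable R : realType.

Lemma complete_tends (V : completeNormedModType R[i]) (u : nat -> V) :
  cauchy_seq u -> exists l, tends u l.
Proof.
move=> cu; have : cauchy (u n @[n --> \oo]).
  apply/cauchy_exP => e e0; have er : e = (complex.Re e)%:C.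
    by rewrite RRe_real// gtr0_real.
  have [|N uN] := cu (complex.Re e / 2).
    by rewrite divr_gt0// -(ltcR 0) -er.
  exists (u N), N => // n Nn; rewrite /= -ball_normE /= er -nrmE ltcR.
  rewrite (le_lt_trans (uN N n _ _))//.
  have : 0 < complex.Re e by rewrite -(ltcR 0) -er.
  lra.
move=> /cauchy_cvg /cvg_ex[l /cvgrPdist_le ul]; exists l => e e0.
have [|N _ uN] := ul e%:C; first by rewrite ltcR.
by exists N => n /uN/=; rewrite distrC le_nrm.
Qed.

Lemma tends_complete (V : normedModType R[i]) :
  (forall u : nat -> V, cauchy_seq u -> exists l, tends u l) ->
  forall F : set_system V, ProperFilter F -> cauchy F -> cvg F.
Proof.
move=> H F FF /cauchy_ballP cF.
have e0 n : 0 < (n.+1%:R^-1 : R) by rewrite invr_gt0.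
have /choice[x xF] n : exists x, F (ball x (n.+1%:R^-1 : R)%:C).
  have e0' : 0 < (n.+1%:R^-1 : R)%:C :> R[i] by rewrite ltcR.
  have [[A B] /= [FA FB] AB] := cF _ e0'.
  have [a Aa] := filter_ex FA; exists a; apply: filterS FB => b Bb.
  by apply: (AB (a, b)).
have small (e : R) : 0 < e ->
    exists N, forall n, (N <= n)%N -> (n.+1%:R^-1 : R) <= e.
  have /cvgrPdist_le hR := @cvg_harmonic R.
  move=> /hR[N _ HN].
  by exists N => n /HN; rewrite /= add0r normrN ger0_norm// ltW.
have xx m n : nrm (x m - x n) <= m.+1%:R^-1 + n.+1%:R^-1.
  have [y [/= my ny]] := filter_ex (filterI (xF m) (xF n)).
  move: my ny; rewrite -!ball_normE /= -!nrmE !ltcR => my ny.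
  have := nrm_tri (x m) y (x n); rewrite (nrmBC y) => h.
  by rewrite (le_trans h)// lerD// ltW.
have [|l xl] := H x.
  move=> e e1; have [|N HN] := small (e / 2); first by lra.
  exists N => m n /HN hm /HN hn; rewrite (le_trans (xx m n))//.
  by rewrite (le_trans (lerD hm hn))// -splitr.
apply/cvg_ex; exists l; apply/cvgrPdist_le => e e1.
have er : e = (complex.Re e)%:C by rewrite RRe_real// gtr0_real.
have e2 : 0 < complex.Re e by rewrite -(ltcR 0) -er.
have [|N HN] := small (complex.Re e / 2); first by lra.
have [|M HM] := xl (complex.Re e / 2); first by lra.
have := HN _ (leq_maxl N M); have hM := HM _ (leq_maxr N M).
set d := _^-1 => hN; apply: filterS (xF (maxn N M)) => y; rewrite -/d -ball_normE /= -nrmE ltcR => hy.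
rewrite er -nrmE lecR.
by have := nrm_tri l (x (maxn N M)) y; rewrite (nrmBC l (x _)); lra.
Qed.

Lemma complex_complete (u : nat -> R[i]) : cauchy_seq u -> exists l, tends u l.
Proof.
move=> cu.
have key (f : R[i] -> R) : (forall c d, f c - f d = f (c - d)) ->
    (forall c, `|f c| <= nrm c) -> exists l : R, forall e, 0 < e ->
    exists N, forall n, (N <= n)%N -> `|f (u n) - l| <= e.
  move=> fB fn; have : cauchy (f (u n) @[n --> \oo]).
    apply/cauchy_exP => e e0; have [|N uN] := cu (e / 2); first by lra.
    exists (f (u N)), N => // n Nn; rewrite /= -ball_normE /= fB.
    rewrite (le_lt_trans (fn _))// (le_lt_trans (uN N n _ _))//; lra.
  move=> /cauchy_cvg /cvg_ex[l /cvgrPdist_le ul]; exists l => e e0.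
  have [N _ uN] := ul e e0; exists N => n /uN/=.
  by rewrite distrC.
have [a Ha] := key (@complex.Re R) (fun c d => esym (raddfB _ c d)) (@Re_le_nrm R).
have [b Hb] := key (@complex.Im R) (fun c d => esym (raddfB _ c d)) (@Im_le_nrm R).
exists (Complex a b) => e e0; have e20 : 0 < e / 2 by lra.
have [N HN] := Ha _ e20; have [M HM] := Hb _ e20.
exists (maxn N M) => n; rewrite geq_max => /andP[/HN hn /HM hm].
have := nrm_le_ReIm (u n - Complex a b); move: hn hm.
by case: (u n) => s t /=; lra.
Qed.

End Completeness.

(** * Square roots in a C*-algebra *)

Section CstarNorm.
Variables (R : realType) (A : cstarType R).
Implicit Types a b c x y z : A.

Lemma nrm_mul x y : nrm (x ** y) <= nrm x * nrm y.
Proof. by rewrite le_nrm rmorphM /= !nrmE cstar_normM. Qed.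

Lemma nrm_star x : nrm (star x) = nrm x.
Proof. by rewrite /nrm star_norm. Qed.

Lemma nrm_cstar x : nrm (star x ** x) = nrm x ^+ 2.
Proof. by apply: complexI; rewrite rmorphXn /= !nrmE cstar_identity. Qed.

Lemma nrm_sa x : star x = x -> nrm (x ** x) = nrm x ^+ 2.
Proof. by move=> xx; rewrite -{1}xx nrm_cstar. Qed.

Lemma amulN x y : x ** (- y) = - (x ** y).
Proof. by rewrite -scaleN1r amulZr scaleN1r. Qed.

Lemma amulNl x y : (- x) ** y = - (x ** y).
Proof. by rewrite -scaleN1r amulZl scaleN1r. Qed.

Lemma amulBr x y z : x ** (y - z) = x ** y - x ** z.
Proof. by rewrite amulDr amulN. Qed.

Lemma amulBl x y z : (x - y) ** z = x ** z - y ** z.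
Proof. by rewrite amulDl amulNl. Qed.

Lemma starN x : star (- x) = - star x.
Proof. by rewrite -scaleN1r starZ rmorphN rmorph1 scaleN1r. Qed.

Lemma star0 : star (0 : A) = 0.
Proof. by rewrite -[X in star X](scale0r (0 : A)) starZ rmorph0 scale0r. Qed.

Lemma starB x y : star (x - y) = star x - star y.
Proof. by rewrite starD starN. Qed.

Lemma starZr (r : R) x : star (r%:C *: x) = r%:C *: star x.
Proof. by rewrite starZ conj_real. Qed.

Lemma nrmZr (r : R) x : nrm (r%:C *: x) = `|r| * nrm x.
Proof. by rewrite nrmZ nrmr. Qed.

(* [1 - c = (1 - y)^2], written without a unit. The solution is the fixed     *)
(* point of [y |-> (c + y^2) / 2], a [|c|]-contraction of the [|c|]-ball.     *)
Lemma cstar_sqrt c : star c = c -> nrm c < 1 ->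
  exists y, [/\ star y = y, y + y - y ** y = c, nrm y <= nrm c
    & forall z, z ** c = c ** z -> z ** y = y ** z].
Proof.
move=> cc; set k := nrm c => k1; have k0 : 0 <= k by apply: nrm_ge0.
pose f y := (2^-1 : R)%:C *: (c + y ** y).
have h0 : 0 < 2^-1 :> R by rewrite invr_gt0.
have fk y : nrm y <= k -> nrm (f y) <= k.
  move=> yk; rewrite nrmZr (ger0_norm (ltW h0)).
  have yy : nrm y * nrm y <= k * k by rewrite ler_pM ?nrm_ge0.
  have kk : k * k <= k * 1 by rewrite ler_wpM2l// ltW.
  have := nrmD c (y ** y); have := nrm_mul y y; rewrite -/k.
  by lra.
have fB x y : nrm x <= k -> nrm y <= k -> nrm (f x - f y) <= k * nrm (x - y).
  move=> xk yk; rewrite -scalerBr opprD addrACA subrr add0r.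
  have -> : x ** x - y ** y = x ** (x - y) + (x - y) ** y.
    by rewrite amulBr amulBl addrA subrK.
  rewrite nrmZr (ger0_norm (ltW h0)).
  have := nrmD (x ** (x - y)) ((x - y) ** y).
  have := nrm_mul x (x - y); have := nrm_mul (x - y) y.
  have : nrm x * nrm (x - y) <= k * nrm (x - y) by rewrite ler_wpM2r ?nrm_ge0.
  have : nrm (x - y) * nrm y <= k * nrm (x - y).
    by rewrite mulrC ler_wpM2r ?nrm_ge0.
  by lra.
pose u n := iter n f 0.
have uk n : nrm (u n) <= k by elim: n => [|n IH]; rewrite ?nrm0//; exact: fk.
have unm n m : nrm (u (n + m)%N - u n) <= k * k ^+ n.
  elim: n => [|n IH]; first by rewrite subr0 mulr1 uk.
  rewrite addSn /u !iterS -/(u _) -/(u _) (le_trans (fB _ _ _ _))//.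
  by rewrite exprS; apply: ler_wpM2l.
have [y uy] := complete_tends (cauchy_seq_expr k0 k1 unm).
have yk : nrm y <= k by apply: (@tends_le _ _ _ _ _ 0%N uy) => n _.
(* Maps that are Lipschitz at [y] and agree on all iterates agree at [y]; self-adjointness and
   commutation pass to the limit in this way. *)
have limP (g h : A -> A) (C D : R) :
    (forall x, nrm (g x - g y) <= C * nrm (x - y)) ->
    (forall x, nrm (h x - h y) <= D * nrm (x - y)) ->
    (forall n, g (u n) = h (u n)) -> g y = h y.
  move=> gC hD gh; apply: tends_uniq (tends_bounded_map gC uy) _.
  by rewrite (_ : g \o u = h \o u);
    [exact: tends_bounded_map hD uy | apply/funext => n /=].
have fy : f y = y.
  apply/eqP; rewrite -subr_eq0; apply/eqP/nrm0_eq0/(@le_epsP _ _ _ 2) => e e0 _.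
  have [N uN] := uy e e0; have := fB _ _ yk (uk N).
  have := uN N (leqnn N); have := uN N.+1 (leqnSn N).
  rewrite /u iterS -/(u N) => h1 h2 h3; have := nrm_tri (f y) (f (u N)) y.
  have : k * nrm (y - u N) <= nrm (y - u N) by rewrite ler_piMl ?nrm_ge0// ltW.
  by move: h3; rewrite (nrmBC y); lra.
have fsa x : star x = x -> star (f x) = f x.
  by move=> xx; rewrite /f starZr starD starM cc xx.
have fcomm z x : z ** c = c ** z -> z ** x = x ** z -> z ** f x = f x ** z.
  by move=> zc zx; rewrite amulZr amulZl amulDr amulDl zc !amulA zx -!amulA zx.
exists y; split=> //.
- apply: (limP star id 1 1) => [x|x|]; rewrite ?mul1r//.
    by rewrite -starB nrm_star.
  elim=> [|n IH]; first by rewrite /u /= star0.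
  exact: fsa.
- apply/eqP; rewrite subr_eq; apply/eqP.
  have two : y + y = (2 : R)%:C *: y by rewrite rmorph_nat scaler_nat mulr2n.
  rewrite two -{1}fy scalerA -rmorphM /= mulfV ?pnatr_eq0//.
  by rewrite scale1r.
- move=> z zc; apply: (limP (fun x => z ** x) (fun x => x ** z) (nrm z) (nrm z)).
  + by move=> x; rewrite -amulBr nrm_mul.
  + by move=> x; rewrite -amulBl mulrC nrm_mul.
  + elim=> [|n IH]; last exact: fcomm.
    by rewrite /u /= mula0 mul0a.
Qed.

Lemma tendsZ (V : normedModType R[i]) (c : R[i]) (u : nat -> V) l :
  tends u l -> tends (fun n => c *: u n) (c *: l).
Proof.
apply: (@tends_bounded_map _ _ _ ( *:%R c) (nrm c)) => x.
by rewrite -scalerBr nrmZ.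
Qed.

Lemma tends_mull a (u : nat -> A) l :
  tends u l -> tends (fun n => a ** u n) (a ** l).
Proof.
apply: (@tends_bounded_map _ _ _ (amul a) (nrm a)) => x.
by rewrite -amulBr nrm_mul.
Qed.

Lemma tends_mulr a (u : nat -> A) l :
  tends u l -> tends (fun n => u n ** a) (l ** a).
Proof.
apply: (@tends_bounded_map _ _ _ (amul ^~ a) (nrm a)) => x.
by rewrite -amulBl mulrC nrm_mul.
Qed.

End CstarNorm.

(** * The multiplier algebra as a C*-algebra *)

Section MultiplierNorm.
Variables (R : realType) (A : cstarType R).
Implicit Types (m n : multiplier A) (x y z : A).

Let bounds m := [set t : R | 0 <= t /\ forall z, nrm (mleft m z) <= t * nrm z].

(** The operator norm of the left action alone: it determines the right action ([mleft_inj]), which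
    obeys the same bound ([nrm_mright]). *)
Definition mult_norm m : R := inf (bounds m).

Let has_inf_bounds m : has_inf (bounds m).
Proof.
split; last by exists 0 => t [].
have [M M0 mM] := mleft_bounded m; exists (nrm M); split; first exact: nrm_ge0.
by move=> z; rewrite le_nrm rmorphM /= !nrmE (ger0_norm M0).
Qed.

Lemma mult_norm_ge0 m : 0 <= mult_norm m.
Proof. by apply: lb_le_inf => [|t []//]; have [] := has_inf_bounds m. Qed.

Lemma mult_norm_le m (t : R) :
  0 <= t -> (forall z, nrm (mleft m z) <= t * nrm z) -> mult_norm m <= t.
Proof.
by move=> t0 mt; apply: ge_inf => //; have [] := has_inf_bounds m.
Qed.

Lemma mult_normP m z : nrm (mleft m z) <= mult_norm m * nrm z.
Proof.
have [[t [t0 mt]] _] := has_inf_bounds m.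
have [z0|z0] := eqVneq (nrm z) 0; first by have := mt z; rewrite z0 !mulr0.
have {}z0 : 0 < nrm z by rewrite lt_def z0 nrm_ge0.
rewrite -ler_pdivrMr//; apply: lb_le_inf; first by exists t.
by move=> s [_ ms]; rewrite ler_pdivrMr.
Qed.

(** The difference [d] of the right actions at [x] satisfies [d ** y = 0] for all [y]; take
    [y = star d] and use the C*-identity. *)
Lemma mleft_inj m n : mleft m =1 mleft n -> m = n.
Proof.
move=> mn; apply: multiplier_eq => // x.
have H y : mright m x ** y = mright n x ** y by rewrite -!mcentral mn.
apply/eqP; rewrite -subr_eq0; apply/eqP; set d := _ - _.
have d0 : d ** star d = 0 by rewrite /d amulBl H subrr.
have := nrm_cstar (star d); rewrite starK d0 nrm0 nrm_star => /esym/eqP.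
by rewrite expf_eq0 nrm_eq0 => /eqP.
Qed.

Lemma mult_norm_mul m n : mult_norm (m ** n) <= mult_norm m * mult_norm n.
Proof.
apply: mult_norm_le => [|z /=]; first by rewrite mulr_ge0 ?mult_norm_ge0.
by rewrite (le_trans (mult_normP _ _))// -mulrA ler_wpM2l ?mult_norm_ge0 ?mult_normP.
Qed.

(** By the C*-identity of [A], [|m z|^2] is the norm of [star z ** (star m ** m) z]. *)
Lemma mult_norm_sqr_le m : mult_norm m ^+ 2 <= mult_norm (star m ** m).
Proof.
set s := mult_norm (star m ** m).
have s0 : 0 <= s by apply: mult_norm_ge0.
suff : mult_norm m <= Num.sqrt s.
  by move=> h; rewrite -(sqr_sqrtr s0) ler_pXn2r ?nnegrE ?sqrtr_ge0 ?mult_norm_ge0.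
apply: mult_norm_le => [|z]; first exact: sqrtr_ge0.
rewrite -(@ler_pXn2r _ 2) ?nnegrE ?nrm_ge0 ?mulr_ge0 ?sqrtr_ge0 ?nrm_ge0//.
rewrite exprMn sqr_sqrtr// -nrm_cstar.
rewrite (_ : _ ** _ = star z ** mleft (star m ** m) z); last first.
  transitivity (mright (star m) (star z) ** mleft m z); last by rewrite -mcentral.
  by rewrite /= starK.
rewrite (le_trans (nrm_mul _ _))// nrm_star expr2 mulrA (mulrC s) -mulrA.
by rewrite ler_wpM2l ?nrm_ge0 ?mult_normP.
Qed.

Lemma mult_norm_star m : mult_norm (star m) = mult_norm m.
Proof.
have H n : mult_norm n <= mult_norm (star n).
  have [n0|n0] := leP (mult_norm n) 0.
    by rewrite (le_trans n0)// mult_norm_ge0.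
  rewrite -(ler_pM2l n0) [leRHS]mulrC (le_trans _ (mult_norm_mul _ _))//.
  exact: mult_norm_sqr_le.
by apply/eqP; rewrite eq_le H -{2}[m]starK H.
Qed.

Fact mult_norm_normD m n :
  (mult_norm (m + n))%:C <= (mult_norm m)%:C + (mult_norm n)%:C.
Proof.
rewrite -rmorphD lecR; apply: mult_norm_le => [|z /=].
  by rewrite addr_ge0 ?mult_norm_ge0.
by rewrite mulrDl (le_trans (nrmD _ _))// lerD ?mult_normP.
Qed.

Fact mult_norm_normZ (c : R[i]) m :
  (mult_norm (c *: m))%:C = `|c| * (mult_norm m)%:C.
Proof.
have le d n : mult_norm (d *: n) <= nrm d * mult_norm n.
  apply: mult_norm_le => [|z]; first by rewrite mulr_ge0 ?nrm_ge0 ?mult_norm_ge0.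
  by rewrite /= nrmZ -mulrA ler_wpM2l ?nrm_ge0 ?mult_normP.
rewrite -nrmE -rmorphM; congr _%:C; apply/eqP; rewrite eq_le le /=.
have [->|c0] := eqVneq c 0; first by rewrite nrm0 mul0r mult_norm_ge0.
have n0 : 0 < nrm c by rewrite lt_def nrm_eq0 c0 nrm_ge0.
rewrite -ler_pdivlMl//; have := le c^-1 (c *: m).
rewrite scalerA mulVf// scale1r; congr (_ <= _ * _).
by apply: complexI; rewrite nrmE fmorphV /= nrmE normfV.
Qed.

Fact mult_norm_eq0 m : (mult_norm m)%:C = 0 -> m = 0.
Proof.
move=> /(@complexI R) m0; apply: mleft_inj => z /=; apply: nrm0_eq0.
by rewrite (le_trans (mult_normP _ _))// m0 mul0r.
Qed.

HB.instance Definition _ := Lmodule_isNormed.Build R[i] (multiplier A)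
  mult_norm_normD mult_norm_normZ mult_norm_eq0.

Lemma nrm_mult m : nrm m = mult_norm m.
Proof. by []. Qed.

Lemma nrm_mright m z : nrm (mright m z) <= mult_norm m * nrm z.
Proof.
rewrite -mult_norm_star -(nrm_star z) -[mright m z]starK nrm_star.
by rewrite -{1}[z]starK; exact: (mult_normP (star m) (star z)).
Qed.

(** Both actions converge pointwise and the multiplier axioms pass to the limits. The Cauchy
    estimate is uniform on the unit ball, so the convergence is in norm. *)
Lemma multiplier_seq_complete (u : nat -> multiplier A) :
  cauchy_seq u -> exists l, tends u l.
Proof.
move=> cu; have [M M0 uM] := cauchy_bounded cu.
have cl z : cauchy_seq (fun i => mleft (u i) z).
  apply: (cauchy_seq_le (C := nrm z) _ cu) => i j.
  by rewrite mulrC -scaleN1r; exact: (mult_normP (u i - u j) z).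
have cr z : cauchy_seq (fun i => mright (u i) z).
  apply: (cauchy_seq_le (C := nrm z) _ cu) => i j.
  by rewrite mulrC -scaleN1r; exact: (nrm_mright (u i - u j) z).
have /choice[l ul] z := complete_tends (cl z).
have /choice[r ur] z := complete_tends (cr z).
have ll : linear l.
  move=> c x y; apply: tends_uniq_ext (ul _) (tendsD (tendsZ c (ul x)) (ul y)).
  by move=> n; rewrite mleft_linear.
have lr : linear r.
  move=> c x y; apply: tends_uniq_ext (ur _) (tendsD (tendsZ c (ur x)) (ur y)).
  by move=> n; rewrite mright_linear.
have bnd (f : A -> A) : (forall z, nrm (f z) <= M * nrm z) -> bounded_map f.
  move=> fM; exists M%:C => [|z]; first by rewrite ler0c.
  by rewrite -!nrmE -rmorphM lecR.
have bl : bounded_map l.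
  apply: bnd => z; apply: (@tends_le _ _ _ _ _ 0%N (ul z)) => n _.
  by rewrite (le_trans (mult_normP _ _))// ler_wpM2r ?nrm_ge0// uM.
have br : bounded_map r.
  apply: bnd => z; apply: (@tends_le _ _ _ _ _ 0%N (ur z)) => n _.
  by rewrite (le_trans (nrm_mright _ _))// ler_wpM2r ?nrm_ge0// uM.
have lM x y : l (x ** y) = l x ** y.
  by apply: tends_uniq_ext (ul _) (tends_mulr y (ul x)) => n; rewrite mleftM.
have rM x y : r (x ** y) = x ** r y.
  by apply: tends_uniq_ext (ur _) (tends_mull x (ur y)) => n; rewrite mrightM.
have lr_central x y : x ** l y = r x ** y.
  by apply: tends_uniq_ext (tends_mull x (ul y)) (tends_mulr y (ur x)) => n;
    rewrite mcentral.
exists (Multiplier ll lr bl br lM rM lr_central) => e e0.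
have [N uN] := cu e e0; exists N => n Nn.
apply: mult_norm_le => [|z]; first exact: ltW.
rewrite /= scaleN1r -nrmN opprB.
have h : tends (fun k => mleft (u k) z - mleft (u n) z) (l z - mleft (u n) z).
  exact: tendsD (ul z) (tends_cst _).
apply: (tends_le (N := N) h) => k Nk; rewrite -scaleN1r.
rewrite (le_trans (mult_normP (u k - u n) z))// ler_wpM2r ?nrm_ge0//.
exact: uN.
Qed.

HB.instance Definition _ := Uniform_isComplete.Build (multiplier A)
  (tends_complete multiplier_seq_complete).

Fact mult_normM m n : `|m ** n| <= `|m| * `|n|.
Proof. by rewrite -!nrmE -rmorphM lecR; exact: mult_norm_mul. Qed.

Fact mult_cstar_identity m : `|star m ** m| = `|m| ^+ 2.
Proof.
rewrite -!nrmE -rmorphXn; congr _%:C; apply/eqP.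
rewrite eq_le; apply/andP; split; last exact: mult_norm_sqr_le.
by rewrite (le_trans (mult_norm_mul _ _))// mult_norm_star.
Qed.

HB.instance Definition _ := StarAlgebra_isCstar.Build R (multiplier A)
  mult_normM mult_cstar_identity.

Definition mult_one : multiplier A.
Proof.
apply: (@Multiplier R A id id) => //.
- by exists 1 => // x; rewrite mul1r.
- by exists 1 => // x; rewrite mul1r.
Defined.

Lemma mul_mult_one m : mult_one ** m = m.
Proof. exact: multiplier_eq. Qed.

Lemma mult_one_mul m : m ** mult_one = m.
Proof. exact: multiplier_eq. Qed.

Lemma star_mult_one : star mult_one = mult_one.
Proof. by apply: multiplier_eq => x /=; rewrite starK. Qed.

Lemma nrm_mult_one (x : A) : x <> 0 -> nrm mult_one = 1.
Proof.
move=> /eqP x0; have o0 : nrm mult_one != 0.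
  apply: contra_neq x0 => o0; apply: nrm0_eq0.
  by have := mult_normP mult_one x; rewrite -nrm_mult o0 mul0r.
apply: (mulfI o0); rewrite mulr1 -expr2 -nrm_cstar star_mult_one.
by rewrite mul_mult_one.
Qed.

(** The lower bound comes from testing on [star x], where [|x ** star x| = |x|^2]. *)
Lemma nrm_mult_embed (x : A) : nrm (mult_embed x) = nrm x.
Proof.
apply/eqP; rewrite eq_le mult_norm_le ?nrm_ge0//=; last exact: nrm_mul.
have [->|x0] := eqVneq x 0; first by rewrite nrm0 nrm_ge0.
have n0 : 0 < nrm x by rewrite lt_def nrm_eq0 x0 nrm_ge0.
rewrite -(ler_pM2r n0) -expr2 -{1}(nrm_star x) -nrm_cstar starK.
by have := mult_normP (mult_embed x) (star x); rewrite nrm_star.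
Qed.

Lemma mult_embed_linear : linear (@mult_embed R A).
Proof.
by move=> c x y; apply: multiplier_eq => z /=;
  rewrite ?amulDl ?amulDr ?amulZl ?amulZr.
Qed.

Lemma mult_embedM x y : mult_embed (x ** y) = mult_embed x ** mult_embed y.
Proof. by apply: multiplier_eq => z /=; rewrite amulA. Qed.

Lemma mult_embed_star x : mult_embed (star x) = star (mult_embed x).
Proof. by apply: multiplier_eq => z /=; rewrite starM starK. Qed.

Lemma mult_mul_embed m x : m ** mult_embed x = mult_embed (mleft m x).
Proof. by apply: multiplier_eq => z /=; rewrite ?mleftM// mcentral. Qed.

End MultiplierNorm.

(** * Positive elements *)

Section Positivity.
Variables (R : realType) (U : cstarType R) (e : U).
Hypotheses (mul1a : forall x : U, e ** x = x) (mula1 : forall x : U, x ** e = x).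
Hypothesis (nrm1 : nrm e = 1).
Implicit Types (a b c h w x y z : U) (r s t : R).

Lemma star_unit : star e = e.
Proof. by rewrite -[LHS]mula1 -{2}[e]starK -starM mula1 starK. Qed.

Local Notation sc r := (r%:C *: e).

Lemma star_sc r : star (sc r) = sc r.
Proof. by rewrite starZr star_unit. Qed.

Lemma nrm_sc r : nrm (sc r) = `|r|.
Proof. by rewrite nrmZr nrm1 mulr1. Qed.

Lemma scD r s : sc (r + s) = sc r + sc s.
Proof. by rewrite rmorphD scalerDl. Qed.

Lemma scB r s : sc (r - s) = sc r - sc s.
Proof. by rewrite rmorphB scalerBl. Qed.

Lemma mul_sc r x : sc r ** x = r%:C *: x.
Proof. by rewrite amulZl mul1a. Qed.

Lemma mulr_sc r x : x ** sc r = r%:C *: x.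
Proof. by rewrite amulZr mula1. Qed.

Lemma scZ r s : r%:C *: sc s = sc (r * s).
Proof. by rewrite scalerA rmorphM. Qed.

Definition pos a : Prop :=
  star a = a /\ exists2 t, 0 <= t & nrm (sc t - a) <= t.

Lemma pos_sa a : pos a -> star a = a. Proof. by case. Qed.

Lemma pos_mono a s t : nrm (sc t - a) <= t -> t <= s -> nrm (sc s - a) <= s.
Proof.
move=> ta ts; rewrite -[s in sc s](subrK t) scD -addrA.
rewrite (le_trans (nrmD _ _))// nrm_sc ger0_norm ?subr_ge0//; lra.
Qed.

Lemma posD a b : pos a -> pos b -> pos (a + b).
Proof.
move=> [aa [s s0 sa]] [bb [t t0 tb]]; split; first by rewrite starD aa bb.
exists (s + t); first exact: addr_ge0.
by rewrite scD opprD addrACA (le_trans (nrmD _ _))// lerD.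
Qed.

Lemma posZ r a : 0 <= r -> pos a -> pos (r%:C *: a).
Proof.
move=> r0 [aa [s s0 sa]]; split; first by rewrite starZr aa.
exists (r * s); first exact: mulr_ge0.
by rewrite -scZ -scalerBr nrmZr ger0_norm// ler_wpM2l.
Qed.

Lemma posB_sa a t : star a = a -> nrm a <= t -> pos (sc t - a).
Proof.
move=> aa at_; split; first by rewrite starB star_sc aa.
exists t; first by rewrite (le_trans _ at_)// nrm_ge0.
by rewrite opprB addrC subrK.
Qed.

Lemma unital_sqrt c : star c = c -> nrm c < 1 ->
  exists y, [/\ star y = y, (e - y) ** (e - y) = e - c, nrm y <= nrm c
    & forall z, z ** c = c ** z -> z ** y = y ** z].
Proof.
move=> cc c1; have [y [yy yc ny comm]] := cstar_sqrt cc c1.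
exists y; split=> //; rewrite -yc amulBl !amulBr !mul1a mula1.
by zmod.
Qed.

Lemma cartesian_mul h k : star h = h -> star k = k ->
  (star (h + 'i *: k) ** (h + 'i *: k) = h ** h + k ** k + 'i *: (h ** k - k ** h))
  * ((h + 'i *: k) ** star (h + 'i *: k) =
     h ** h + k ** k - 'i *: (h ** k - k ** h)).
Proof.
move=> hh kk; rewrite starD starZ hh kk conjCi scaleNr; split.
  rewrite amulBl !amulDr !amulZr !amulZl scalerBr.
  by rewrite scalerA -expr2 sqrCi scaleN1r; zmod.
rewrite amulDl !amulBr !amulZr !amulZl scalerBr.
by rewrite scalerA -expr2 sqrCi scaleN1r; zmod.
Qed.

Lemma cartesian_le h k : star h = h -> star k = k -> nrm h <= nrm (h + 'i *: k).
Proof.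
move=> hh kk; set w := _ + _.
have ->: h = (2^-1 : R)%:C *: (w + star w).
  rewrite /w starD starZ hh kk conjCi scaleNr addrACA subrr addr0.
  rewrite scalerDr -scalerDl -rmorphD /= (_ : 2^-1 + 2^-1 = 1) ?scale1r//.
  by lra.
rewrite nrmZr ger0_norm ?invr_ge0//.
by have := nrmD w (star w); rewrite nrm_star; lra.
Qed.

(** Let [k] be a square root of [1 - y^2] commuting with [y]. Then [w = k + 'i *: y] has
    [star w ** w = 1], so its real part [k] is a contraction, and [|1 - y^2| = |k|^2]. *)
Lemma pos_sq_lt1 y : star y = y -> nrm y < 1 -> nrm (e - y ** y) <= 1.
Proof.
move=> yy y1; have c1 : nrm (y ** y) < 1.
  by rewrite nrm_sa// expr_lt1// nrm_ge0.
have [|h [hh hc _ hcomm]] := @unital_sqrt (y ** y) _ c1.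
  by rewrite starM yy.
set k := e - h; have kk : star k = k by rewrite starB star_unit hh.
have yk : y ** k = k ** y.
  by rewrite amulBr amulBl mul1a mula1 hcomm// amulA.
have w1 : nrm (k + 'i *: y) = 1.
  apply/eqP; rewrite -sqrp_eq1 ?nrm_ge0//.
  rewrite -nrm_cstar (cartesian_mul kk yy).1 yk subrr scaler0 addr0 hc subrK.
  by rewrite nrm1.
have k1 : nrm k <= 1 by rewrite -w1 cartesian_le.
by rewrite -hc nrm_sa// expr_le1 ?nrm_ge0.
Qed.

Lemma nrm_sc_sq y s : star y = y -> nrm y < s ->
  nrm (sc (s ^+ 2) - y ** y) <= s ^+ 2.
Proof.
move=> yy ys; have s0 : 0 < s by rewrite (le_lt_trans _ ys)// nrm_ge0.
have := @pos_sq_lt1 (s^-1%:C *: y); rewrite starZr yy nrmZr.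
rewrite gtr0_norm ?invr_gt0// mulrC ltr_pdivrMr// mul1r => /(_ erefl ys).
rewrite amulZl amulZr scalerA -rmorphM /= => H.
have -> : sc (s ^+ 2) - y ** y =
    (s ^+ 2)%:C *: (e - (s^-1 * s^-1)%:C *: (y ** y)).
  rewrite scalerBr scalerA -rmorphM /=; congr (_ - _).
  by rewrite (_ : s ^+ 2 * _ = 1) ?scale1r//; field; rewrite gt_eqF.
by rewrite nrmZr ger0_norm ?sqr_ge0// ler_piMr// sqr_ge0.
Qed.

Lemma pos_sq y : star y = y -> pos (y ** y).
Proof.
move=> yy; split; first by rewrite starM yy.
exists ((nrm y + 1) ^+ 2); first exact: sqr_ge0.
by apply: nrm_sc_sq => //; rewrite ltrDl.
Qed.

Lemma nrm_sc_sq_le y : star y = y ->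
  nrm (sc (nrm y ^+ 2) - y ** y) <= nrm y ^+ 2.
Proof.
move=> yy; set n := nrm y; have n0 : 0 <= n by apply: nrm_ge0.
(* Passing from [n + d] to [n] costs [2 * ((n + d)^2 - n^2)], at most [(4 * n + 2) * d] for
   [d <= 1]. *)
apply: (@le_epsP _ _ _ (4 * n + 2)) => d d0 d1.
have := @nrm_sc_sq y (n + d) yy; rewrite ltrDl => /(_ d0) H.
have -> : sc (n ^+ 2) - y ** y =
    (sc ((n + d) ^+ 2) - y ** y) - sc ((n + d) ^+ 2 - n ^+ 2).
  by rewrite scB; zmod.
rewrite (le_trans (nrmB _ _))// nrm_sc ger0_norm; nra.
Qed.

(** Adding [d] makes the inequality in [pos] strict: [c = 1 - (a + d) / (t + d)] has norm at most
    [t / (t + d) < 1], so [unital_sqrt] applies to it, and its root is rescaled. *)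
Lemma pos_sqrt a (d : R) : pos a -> 0 < d ->
  exists z, [/\ star z = z, z ** z = a + sc d, pos z
    & forall w, w ** a = a ** w -> w ** z = z ** w].
Proof.
move=> [aa [t t0 ta]] d0; set T := t + d; have T0 : 0 < T by rewrite ltr_wpDl.
pose c := e - T^-1%:C *: (a + sc d).
have cc : star c = c.
  by rewrite starB star_unit starZr starD aa star_sc.
have cE : c = T^-1%:C *: (sc t - a).
  have -> : sc t - a = sc T - (a + sc d) by rewrite scD; zmod.
  by rewrite [RHS]scalerBr scZ mulVf ?gt_eqF// rmorph1 scale1r.
have c1 : nrm c < 1.
  rewrite cE nrmZr gtr0_norm ?invr_gt0// mulrC ltr_pdivrMr// mul1r.
  by rewrite (le_lt_trans ta)// ltrDl.
have [y [yy yc ny comm]] := unital_sqrt cc c1.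
have sT : 0 <= Num.sqrt T by rewrite sqrtr_ge0.
have eya : star (e - y) = e - y by rewrite starB star_unit yy.
exists ((Num.sqrt T)%:C *: (e - y)); split.
- by rewrite starZr eya.
- rewrite amulZl amulZr scalerA -rmorphM /= -expr2 sqr_sqrtr ?ltW// yc /c.
  rewrite opprB addrC subrK scalerA -rmorphM /= mulfV ?gt_eqF//.
  by rewrite rmorph1 scale1r.
- apply: posZ => //; rewrite -[e in e - y](scale1r) -(rmorph1 (real_complex R)).
  by apply: posB_sa => //; rewrite (le_trans ny)// ltW.
- move=> w wa; rewrite amulZr amulZl amulBr amulBl mul1a mula1; congr (_ *: (_ - _)).
  by apply: comm; rewrite cE amulZr amulZl amulBr amulBl mul_sc mulr_sc wa.
Qed.

(** Holds for squares by [nrm_sc_sq_le], and [a + d] is a square for every [d > 0]. So positivity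
    has a canonical radius, the norm, which makes it stable under limits in [pos_closed]. *)
Lemma nrm_sc_pos_le a : pos a -> nrm (sc (nrm a) - a) <= nrm a.
Proof.
move=> pa; apply: (@le_epsP _ _ _ 3) => d d0 _.
have [z [zz za _ _]] := pos_sqrt pa d0.
have := nrm_sc_sq_le zz; rewrite -nrm_sa// za; set N := nrm (a + _) => H.
have Na : N <= nrm a + d by rewrite (le_trans (nrmD _ _))// nrm_sc gtr0_norm.
have aN : nrm a <= N + d.
  have := nrmB (a + sc d) (sc d); rewrite addrK nrm_sc gtr0_norm//.
have -> : sc (nrm a) - a = (sc N - (a + sc d)) + sc (nrm a - N + d).
  by rewrite scD scB; zmod.
have N3 : `|nrm a - N + d| <= 2 * d by rewrite ler_norml; apply/andP; split; lra.
by rewrite (le_trans (nrmD _ _))// nrm_sc; lra.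
Qed.

Lemma pos_closed b : star b = b ->
  (forall d : R, 0 < d -> exists2 q, pos q & nrm (b - q) <= d) -> pos b.
Proof.
move=> bb H; split=> //; exists (nrm b); first exact: nrm_ge0.
apply: (@le_epsP _ _ _ 3) => d d0 _; have [q pq bq] := H d d0.
have -> : sc (nrm b) - b = (sc (nrm q) - q) + (sc (nrm b - nrm q) - (b - q)).
  by rewrite scB; zmod.
have qb : nrm q <= nrm b + d by have := nrm_triD q b; rewrite nrmBC; lra.
have bq' : nrm b <= nrm q + d by have := nrm_triD b q; lra.
have N : `|nrm b - nrm q| <= d by rewrite ler_norml; apply/andP; split; lra.
have := nrmD (sc (nrm q) - q) (sc (nrm b - nrm q) - (b - q)).
have := nrmB (sc (nrm b - nrm q)) (b - q); rewrite nrm_sc.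
by have := nrm_sc_pos_le pq; lra.
Qed.

(** A square root [z] of [t - h^2 + d] commutes with [h], so [w = h + 'i *: z] has
    [star w ** w = h^2 + z^2 = t + d], and [h] is the real part of [w]. *)
Lemma pos_sq_bound h t : star h = h -> pos (sc t - h ** h) -> nrm h ^+ 2 <= `|t|.
Proof.
move=> hh pt; apply: le_eps0 => d d0.
have [z [zz zt _ comm]] := pos_sqrt pt d0.
have hz : h ** z = z ** h.
  by apply: comm; rewrite amulBr amulBl mul_sc mulr_sc amulA.
have : nrm (h + 'i *: z) ^+ 2 <= `|t| + d.
  rewrite -nrm_cstar (cartesian_mul hh zz).1 hz subrr scaler0 addr0 zt.
  have -> : h ** h + (sc t - h ** h + sc d) = sc (t + d) by rewrite scD; zmod.
  by rewrite nrm_sc (le_trans (ler_normD _ _))// (gtr0_norm d0).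
apply: le_trans; rewrite ler_pXn2r ?nnegrE ?nrm_ge0//.
exact: cartesian_le.
Qed.

Definition upow x n := iter n (amul x) e.

Lemma upowD x m n : upow x (m + n) = upow x m ** upow x n.
Proof.
by elim: m => [|m IH]; rewrite ?mul1a// addSn /upow !iterS -/(upow _ _) IH amulA.
Qed.

Lemma upow_comm x n : x ** upow x n = upow x n ** x.
Proof.
by elim: n => [|n IH]; rewrite /upow /= ?mul1a ?mula1// -/(upow _ _) {1}IH amulA.
Qed.

Lemma star_upow x n : star x = x -> star (upow x n) = upow x n.
Proof.
move=> xx; elim: n => [|n IH]; first exact: star_unit.
by rewrite /upow iterS -/(upow x n) starM IH xx upow_comm.
Qed.

Lemma nrm_upow_sa x k : star x = x -> nrm (upow x (2 ^ k)) = nrm x ^+ (2 ^ k).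
Proof.
move=> xx; elim: k => [|k IH]; first by rewrite /upow /= mula1.
by rewrite expnS mul2n -addnn upowD nrm_sa ?star_upow// IH exprD.
Qed.

Lemma nrm_upow_le x t n : nrm x <= t -> nrm (upow x n) <= t ^+ n.
Proof.
move=> xt; elim: n => [|n IH]; first by rewrite /upow /= nrm1.
rewrite /upow iterS -/(upow x n) exprS (le_trans (nrm_mul _ _))//.
by rewrite ler_pM ?nrm_ge0.
Qed.

(* The spectra of [star w ** w] and [w ** star w] agree away from zero; at    *)
(* the level of norms this is seen on high powers.                            *)
Lemma nrm_swap w s t : 0 <= s -> s <= t -> 0 < t ->
  nrm (sc s + star w ** w) <= t -> nrm (sc s + w ** star w) <= t.
Proof.
move=> s0 st t0; set g' := sc s + _ => g't; set g := sc s + _.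
pose C := nrm w * nrm w; have C0 : 0 <= C by rewrite mulr_ge0 ?nrm_ge0.
have gg : star g = g by rewrite starD star_sc starM starK.
have wg n : star w ** upow g n = upow g' n ** star w.
  elim: n => [|n IH]; first by rewrite /upow /= mul1a mula1.
  rewrite /upow !iterS -/(upow g n) -/(upow g' n) -amulA -IH !amulA; congr (_ ** _).
  by rewrite /g /g' amulDr amulDl mulr_sc mul_sc amulA.
(* Since [g^(n+1) = s g^n + w g'^n (star w)] and [s <= t], the norm of [g^n] exceeds [t^n] at most
   by a factor linear in [n]. *)
have key n : t * nrm (upow g n) <= (t + n%:R * C) * t ^+ n.
  elim: n => [|n IH]; first by rewrite /upow /= nrm1 expr0 !mulr1 mul0r addr0.
  rewrite {1}/upow iterS -/(upow g n) {1}/g amulDl mul_sc -amulA wg.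
  have h1 : nrm (w ** (upow g' n ** star w)) <= C * t ^+ n.
    rewrite (le_trans (nrm_mul _ _))// /C -mulrA ler_wpM2l ?nrm_ge0//.
    rewrite (le_trans (nrm_mul _ _))// nrm_star mulrC ler_wpM2l ?nrm_ge0//.
    exact: nrm_upow_le.
  have h2 := nrmD (s%:C *: upow g n) (w ** (upow g' n ** star w)).
  rewrite nrmZr (ger0_norm s0) in h2.
  have tn : 0 <= t ^+ n by rewrite exprn_ge0// ltW.
  have h3 : s * nrm (upow g n) <= t * nrm (upow g n) by rewrite ler_wpM2r ?nrm_ge0.
  have h4 : t * nrm (s%:C *: upow g n + w ** (upow g' n ** star w)) <=
      t * ((t + n%:R * C) * t ^+ n + C * t ^+ n).
    by apply: ler_wpM2l; [exact: ltW | lra].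
  rewrite (le_trans h4)// exprS -natr1.
  by rewrite le_eqVlt; apply/orP; left; apply/eqP; ring.
rewrite leNgt; apply/negP => tg.
pose r := nrm g / t - 1; have r0 : 0 < r.
  by rewrite /r subr_gt0 ltr_pdivlMr// mul1r.
have gr : nrm g = (1 + r) * t by rewrite /r addrC subrK divfK// gt_eqF.
have bin n : 1 + n%:R * r <= (1 + r) ^+ n.
  elim: n => [|n IH]; first by rewrite mul0r addr0.
  rewrite exprS -natr1; have : 0 <= n%:R :> R by [].
  nra.
(* On exponents [2^k] the norm of [g] is multiplicative, so the ratio [1 + r] compounds. The square
   of Bernoulli's inequality grows quadratically against the linear bound of [key]. *)
have bnd k : (2 ^ k)%:R * r ^+ 2 <= 1 + 2 * C / t.
  set M := (2 ^ k)%N; have M1 : 1 <= M%:R :> R by rewrite ler1n expn_gt0.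
  have := key (2 ^ k.+1)%N; rewrite nrm_upow_sa// gr exprMn.
  have tn : 0 < t ^+ (2 ^ k.+1) by rewrite exprn_gt0.
  rewrite mulrA ler_pM2r// expnS mul2n -addnn -/M exprD natrD => H.
  have h1 := bin M; have Mr : 0 < M%:R * r by rewrite mulr_gt0// ltr0n expn_gt0.
  have h2 : (M%:R * r) * (M%:R * r) <= (1 + r) ^+ M * (1 + r) ^+ M.
    by apply: ler_pM => //; lra.
  have h3 : t * ((M%:R * r) * (M%:R * r)) <= t + (M%:R + M%:R) * C.
    by rewrite (le_trans _ H)// ler_wpM2l// ltW.
  rewrite -(ler_pM2r t0) mulrDl divfK ?gt_eqF// mul1r.
  rewrite -(@ler_pM2l _ M%:R) ?(lt_le_trans ltr01)//.
  rewrite expr2; nra.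
have [n hn] : exists n : nat, (1 + 2 * C / t) / r ^+ 2 < n%:R.
  exists (Num.bound `|(1 + 2 * C / t) / r ^+ 2|).
  by rewrite (le_lt_trans (ler_norm _))// archi_boundP.
have := bnd n; rewrite leNgt => /negP; apply.
rewrite ltr_pdivrMr ?exprn_gt0// in hn; apply: (lt_le_trans hn).
by rewrite ler_wpM2r ?sqr_ge0// ler_nat ltnW// ltn_expl.
Qed.

(** Since [S - (t - x) = (S - t) + x], [nrm_swap] carries the radius [S] from [t - star w ** w] over
    to [t - w ** star w]. *)
Lemma pos_swap w t : 0 <= t -> pos (sc t - star w ** w) -> pos (sc t - w ** star w).
Proof.
move=> t0 [_ [T T0 HT]]; split; first by rewrite starB star_sc starM starK.
pose S := T + t + 1.
have S0 : 0 < S by rewrite /S; lra.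
have E x : sc S - (sc t - x) = sc (S - t) + x by rewrite scB; zmod.
exists S; first exact: ltW.
rewrite E; apply: nrm_swap => //; rewrite -?E.
- by rewrite /S; lra.
- by rewrite gerBl.
- by apply: pos_mono HT _; rewrite /S; lra.
Qed.

Lemma cartesian_decomp w :
  exists h k, [/\ star h = h, star k = k & w = h + 'i *: k].
Proof.
exists ((2^-1 : R)%:C *: (w + star w)), ((2^-1 : R)%:C *: ('i *: (star w - w))).
split.
- by rewrite starZr starD starK addrC.
- by rewrite starZr starZ starB starK conjCi scaleNr -scalerN opprB.
have -> (a : R[i]) y : 'i *: (a *: ('i *: y)) = a *: (- y).
  by rewrite !scalerA mulrAC -expr2 sqrCi mulN1r scaleNr scalerN.
rewrite opprB -scalerDr.
have -> : w + star w + (w - star w) = w + w by zmod.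
rewrite scalerDr -scalerDl -rmorphD /= (_ : 2^-1 + 2^-1 = 1) ?scale1r//.
by lra.
Qed.

(** At this point [star w ** w] is not yet known to be positive. Adding the bounds on [star w ** w]
    and, by [pos_swap], on [w ** star w] gives [h^2 + k^2 <= t] for the real and imaginary parts of
    [w], and squares are positive. *)
Lemma pos_neg_bound w t : 0 <= t -> pos (sc t - star w ** w) ->
  nrm w <= 2 * Num.sqrt t.
Proof.
move=> t0 p1; have p2 := pos_swap t0 p1.
have [h [k [hh kk wE]]] := cartesian_decomp w.
have E : (sc t - star w ** w) + (sc t - w ** star w) =
    2%:C *: (sc t - h ** h - k ** k).
  rewrite wE (cartesian_mul hh kk).1 (cartesian_mul hh kk).2.
  by rewrite rmorph_nat scaler_nat mulr2n; zmod.
have p3 : pos (sc t - h ** h - k ** k).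
  have := posZ (_ : 0 <= 2^-1) (posD p1 p2).
  by rewrite E scalerA -rmorphM /= mulVf ?pnatr_eq0// rmorph1 scale1r;
    apply; rewrite invr_ge0.
have bnd x : star x = x -> pos (sc t - x ** x) -> nrm x <= Num.sqrt t.
  move=> xx /(pos_sq_bound xx); rewrite ger0_norm// => h1.
  by rewrite -(ger0_norm (nrm_ge0 x)) -sqrtr_sqr ler_wsqrtr.
have hb : nrm h <= Num.sqrt t.
  by apply: bnd => //; have := posD p3 (pos_sq kk); rewrite subrK.
have kb : nrm k <= Num.sqrt t.
  by apply: bnd => //; have := posD p3 (pos_sq hh); rewrite addrAC subrK.
have i1 : nrm ('i : R[i]) = 1 by apply: complexI; rewrite nrmE normCi.
rewrite wE; have := nrmD h ('i *: k); rewrite nrmZ i1; lra.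
Qed.

(* Kaplansky's argument: with [q = sqrt (b^2 + d)], [q - b] is twice the      *)
(* negative part of [b] up to an error controlled by [d], and                 *)
(* [x (q - b)] has an almost negative square.                                 *)
Lemma pos_star_mul x : pos (star x ** x).
Proof.
have [b bE] : exists b, b = star x ** x by exists (star x ** x).
rewrite -bE; have bb : star b = b by rewrite bE starM starK.
pose K := 2 * nrm b + 1; have K1 : 1 <= K.
  by rewrite /K; have := nrm_ge0 b; lra.
pose M := 9 * (K * K + K) * K.
have key d : 0 < d -> d <= 1 ->
    exists2 q, pos q & nrm (b - q) ^+ 4 <= M * d.
  move=> d0 d1.
  have [q [qq q2 pq qcomm]] := pos_sqrt (pos_sq bb) d0.
  have bq : b ** q = q ** b by apply: qcomm; rewrite amulA.
  (* A square root of [q + d]: it makes [q p^2 + d p^2] the square of the self-adjoint [r ** p]. *)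
  have [r [rr r2 pr rcomm]] := pos_sqrt pq d0.
  exists q => //; rewrite nrmBC.
  have [p pE] : exists p, p = q - b by exists (q - b).
  rewrite -pE.
  have pp : star p = p by rewrite pE starB qq bb.
  have pb : b ** p = p ** b by rewrite pE amulBr amulBl bq.
  have pq' : q ** p = p ** q by rewrite pE amulBr amulBl bq.
  have rp : p ** r = r ** p by apply: rcomm; rewrite pq'.
  have qb : nrm q <= nrm b + 1.
    rewrite -(@ler_pXn2r _ 2) ?nnegrE ?nrm_ge0 ?addr_ge0 ?nrm_ge0//.
    rewrite -nrm_sa// q2 (le_trans (nrmD _ _))// nrm_sc nrm_sa// gtr0_norm//.
    by have := nrm_ge0 b; nra.
  have pK : nrm p <= K by have := nrmB q b; rewrite -pE /K; lra.
  have p0 := nrm_ge0 p.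
  have bpE : b ** p = sc d - q ** p.
    by rewrite pE !amulBr q2 bq; zmod.
  pose w := x ** p.
  have wE : star w ** w = b ** (p ** p).
    by rewrite /w starM pp -!amulA [X in p ** X]amulA -bE amulA -pb -amulA.
  pose t := d * (K * K + K).
  have t0 : 0 <= t by rewrite mulr_ge0 ?ltW//; nra.
  (* Here [star w ** w = b p^2 = d p - q p^2], so the difference is [(r p)^2] plus
     [t - d (p^2 + p)], which is positive because [|p| <= K]. *)
  have pwt : pos (sc t - star w ** w).
    have -> : sc t - star w ** w =
        (r ** p) ** (r ** p) + (sc t - d%:C *: (p ** p + p)).
      have -> : (r ** p) ** (r ** p) = q ** (p ** p) + d%:C *: (p ** p).
        rewrite -mul_sc -amulDl -r2 -!amulA [p ** (r ** p)]amulA rp.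
        by rewrite -!amulA.
      by rewrite wE [b ** _]amulA bpE amulBl mul_sc -[q ** p ** p]amulA scalerDr; zmod.
    apply: posD; first by apply: pos_sq; rewrite starM rr pp rp.
    apply: posB_sa; first by rewrite starZr starD starM pp.
    rewrite nrmZr gtr0_norm// /t ler_pM2l//.
    have := nrmD (p ** p) p; rewrite nrm_sa//; nra.
  have w2 : nrm (b ** (p ** p)) <= 4 * t.
    rewrite -wE nrm_cstar -(sqr_sqrtr t0) (_ : 4 = 2 ^+ 2) -?exprMn; last by ring.
    by rewrite ler_pXn2r ?nnegrE ?mulr_ge0 ?sqrtr_ge0 ?nrm_ge0// pos_neg_bound.
  have qE : q ** (p ** p) = d%:C *: p - b ** (p ** p).
    by rewrite [b ** _]amulA bpE amulBl mul_sc -amulA; zmod.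
  (* The cube of [p = q - b] is of order [d], since [q p^2] and [b p^2] both are. *)
  have pppE : p ** (p ** p) = d%:C *: p - 2%:C *: (b ** (p ** p)).
    by rewrite {1}pE amulBl qE rmorph_nat scaler_nat mulr2n; zmod.
  have ppp : nrm (p ** (p ** p)) <= 9 * t.
    rewrite pppE (le_trans (nrmB _ _))// !nrmZr gtr0_norm// (@gtr0_norm _ 2)//.
    have : d * nrm p <= t by rewrite /t ler_pM2l//; nra.
    by lra.
  have -> : nrm p ^+ 4 = nrm (p ** (p ** (p ** p))).
    have -> : p ** (p ** (p ** p)) = (p ** p) ** (p ** p) by rewrite !amulA.
    by rewrite nrm_sa ?starM ?pp// nrm_sa// -exprM.
  rewrite (le_trans (nrm_mul _ _))// /M.
  rewrite (_ : _ * d = K * (9 * t)); last by rewrite /t; ring.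
  by rewrite ler_pM ?nrm_ge0.
apply: pos_closed => // d d0.
have M0 : 0 < M by rewrite /M !mulr_gt0//; nra.
(* The parameter [d^4 / M], capped at one, puts the positive [q] within [d] of [b]. *)
have [||q pq bq] := key (Num.min 1 (d ^+ 4 / M)).
- by rewrite lt_min ltr01 divr_gt0 ?exprn_gt0.
- by rewrite ge_min lexx.
exists q => //; rewrite -(@ler_pXn2r _ 4) ?nnegrE ?nrm_ge0 ?(ltW d0)//.
rewrite (le_trans bq)// mulrC -ler_pdivlMr//.
by rewrite ge_min lexx orbT.
Qed.
End Positivity.

(** * The Hahn-Banach theorem and states *)

Section HahnBanach.
Variables (R : realType) (V : lmodType R[i]).
Implicit Types (p : V -> R) (x y : V).

Definition sublinear p : Prop :=
  (forall x y, p (x + y) <= p x + p y) /\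
  (forall (r : R) x, 0 <= r -> p (r%:C *: x) <= r * p x).

Lemma sublinear0 p : sublinear p -> p 0 = 0.
Proof.
move=> [pD pZ]; have := pD 0 0; have := pZ 0 0 (lexx 0).
by rewrite rmorph0 scale0r addr0 mul0r; lra.
Qed.

Lemma sublinearZ p (r : R) x : sublinear p -> 0 <= r -> p (r%:C *: x) = r * p x.
Proof.
move=> sp; rewrite le_eqVlt => /predU1P[<-|r0].
  by rewrite rmorph0 scale0r mul0r sublinear0.
apply/eqP; rewrite eq_le sp.2 ?(ltW r0)//= -ler_pdivlMl//.
rewrite -{1}[x]scale1r -(rmorph1 (real_complex R)) -(mulVf (lt0r_neq0 r0)).
by rewrite rmorphM -scalerA sp.2// invr_ge0 ltW.
Qed.

Lemma sublinear_opp p x : sublinear p -> - p (- x) <= p x.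
Proof.
by move=> sp; have := sp.1 x (- x); rewrite subrr sublinear0//; lra.
Qed.

(* For a minimal [p] this gives [p (- y) = - p y], so [p] is linear. *)
Lemma sublinear_reduce p y : sublinear p ->
  exists q, [/\ sublinear q, forall x, q x <= p x & q (- y) <= - p y].
Proof.
move=> sp.
(* The new functional is the infimum of [S x]; [s = 1] at [x = - y] gives the required bound
   there. *)
pose S x := [set v : R | exists2 s : R, 0 <= s & v = p (x + s%:C *: y) - s * p y].
have S0 x : S x (p x) by exists 0; rewrite // rmorph0 scale0r mul0r addr0 subr0.
have Sl x : lbound (S x) (- p (- x)).
  move=> _ [s s0 ->]; rewrite -(sublinearZ y sp s0) lerBrDr.
  have := sp.1 (x + s%:C *: y) (- x); rewrite addrAC subrr add0r; lra.
have infS x v : S x v -> inf (S x) <= v by apply: ge_inf; exists (- p (- x)).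
have Sinf x t : (forall v, S x v -> t <= v) -> t <= inf (S x).
  by move=> h; apply: lb_le_inf; [exists (p x) | move=> v; exact: h].
exists (fun x => inf (S x)); split.
- split=> [x x'|r x r0].
    rewrite -lerBlDr; apply: (Sinf) => _ [s s0 ->].
    rewrite lerBlDr -lerBlDl; apply: (Sinf) => _ [t t0 ->]; rewrite lerBlDl.
    have /infS /le_trans : S (x + x') (p (x + x' + (s + t)%:C *: y) - (s + t) * p y).
      by exists (s + t); rewrite ?addr_ge0.
    apply; rewrite rmorphD scalerDl addrACA.
    by have := sp.1 (x + s%:C *: y) (x' + t%:C *: y); lra.
  have [->|r1] := eqVneq r 0.
    rewrite rmorph0 scale0r mul0r (le_trans (infS _ _ (S0 0)))//.
    by rewrite sublinear0.
  have {}r0 : 0 < r by rewrite lt_def r1.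
  rewrite -ler_pdivrMl//; apply: (Sinf) => _ [s s0 ->]; rewrite ler_pdivrMl//.
  apply: (infS); exists (r * s); first by rewrite mulr_ge0// ltW.
  by rewrite rmorphM -scalerA -scalerDr sublinearZ ?ltW// mulrBr mulrA.
- by move=> x; apply: (infS).
- apply: (infS); exists 1 => //.
  by rewrite rmorph1 scale1r addNr sublinear0// mul1r sub0r.
Qed.

(** Zorn's lemma for the reversed pointwise order. A nonempty chain is bounded by its pointwise
    infimum, which is finite because every member is at least [- p (- x)] at [x]. *)
Lemma minimal_sublinear p : sublinear p ->
  exists q, [/\ sublinear q, forall x, q x <= p x &
    forall q', sublinear q' -> (forall x, q' x <= q x) -> q' = q].
Proof.
move=> sp; pose T := {q | sublinear q /\ forall x, q x <= p x}.
pose le (q q' : T) : bool := `[< forall x, sval q' x <= sval q x >].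
have p_lb (q : T) x : - p (- x) <= sval q x.
  by have [sq qp] := svalP q; rewrite (le_trans _ (sublinear_opp _ sq))// lerN2.
have [|r s t /asboolP rs /asboolP st|s t /asboolP st /asboolP ts|C Ctot|q qmin] :=
    @Zorn T le.
- by move=> q; apply/asboolP.
- by apply/asboolP => x; exact: le_trans (st x) (rs x).
- case: s t st ts => [s Ps] [t Pt] /= st ts.
  have e : s = t by apply/funext => x; apply/eqP; rewrite eq_le st ts.
  by subst t; congr exist; exact: Prop_irrelevance.
- have [[q0 Cq0]|C0] := pselect (exists q, C q); last first.
    exists (exist _ p (conj sp (fun x => lexx _))) => s Cs.
    by case: C0; exists s.
  pose S x := [set v : R | exists2 q, C q & v = sval q x].
  have infS x q : C q -> inf (S x) <= sval q x.
    by move=> Cq; apply: ge_inf; [exists (- p (- x)) => _ [r _ ->] | exists q].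
  have Sinf x t : (forall q, C q -> t <= sval q x) -> t <= inf (S x).
    move=> h; apply: lb_le_inf; first by exists (sval q0 x), q0.
    by move=> _ [q Cq ->]; exact: h.
  have sS : sublinear (fun x => inf (S x)).
    split=> [x x'|r x r0].
      rewrite -lerBlDr; apply: (Sinf) => q Cq; rewrite lerBlDr -lerBlDl.
      apply: (Sinf) => q' Cq'; rewrite lerBlDl.
      have [/asboolP qq'|/asboolP qq'] := Ctot q q' Cq Cq'.
        rewrite (le_trans (infS _ _ Cq'))//.
        by rewrite (le_trans ((svalP q').1.1 _ _))// lerD2r.
      rewrite (le_trans (infS _ _ Cq))//.
      by rewrite (le_trans ((svalP q).1.1 _ _))// lerD2l.
    have [->|r1] := eqVneq r 0.
      rewrite rmorph0 scale0r mul0r (le_trans (infS _ _ Cq0))//.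
      by rewrite sublinear0//; exact: (svalP q0).1.
    have {}r0 : 0 < r by rewrite lt_def r1.
    rewrite -ler_pdivrMl//; apply: (Sinf) => q Cq; rewrite ler_pdivrMl//.
    by rewrite (le_trans (infS _ _ Cq))//; apply: (svalP q).1.2; exact: ltW.
  have Sp x : inf (S x) <= p x.
    by rewrite (le_trans (infS _ _ Cq0))//; exact: (svalP q0).2.
  exists (exist _ (fun x => inf (S x)) (conj sS Sp)) => s Cs.
  apply/asboolP => x /=.
  exact: infS.
have [sq qp] := svalP q; exists (sval q); split=> // q' sq' q'q.
have q'p x : q' x <= p x by exact: le_trans (q'q x) (qp x).
by rewrite -(qmin (exist _ q' (conj sq' q'p)))//; apply/asboolP.
Qed.

(** Lower [p] to some [p'] with [p' (- a) <= - p a] and take a minimal [f] below [p']. Reducing [f]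
    along any [y] changes nothing, so [f] is linear, and [f (- a) <= - p a] forces [f a = p a]. *)
Lemma hahn_banach p a : sublinear p ->
  exists f : V -> R, [/\ {morph f : x y / x + y},
    forall (r : R) x, f (r%:C *: x) = r * f x, forall x, f x <= p x & f a = p a].
Proof.
move=> sp; have [p' [sp' p'p p'a]] := sublinear_reduce a sp.
have [f [sf fp fmin]] := minimal_sublinear sp'.
have fN y : f (- y) = - f y.
  have [q [sq qf qy]] := sublinear_reduce y sf.
  rewrite (fmin q sq qf) in qy; apply/eqP; rewrite eq_le qy.
  by have := sublinear_opp y sf; lra.
exists f; split.
- move=> x y; apply/eqP; rewrite eq_le sf.1 /=.
  by have := sf.1 (x + y) (- y); rewrite addrK fN; lra.
- move=> r x; have [r0|r0] := leP 0 r; first exact: sublinearZ.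
  rewrite -[r]opprK rmorphN scaleNr fN sublinearZ ?mulNr// oppr_ge0 ltW//.
- by move=> x; exact: le_trans (fp x) (p'p x).
- apply/eqP; rewrite eq_le (le_trans (fp a) (p'p a)) /=.
  by have := fp (- a); rewrite fN; lra.
Qed.

End HahnBanach.

(** * States on a unital C*-algebra *)

Section UnitalState.
Variables (R : realType) (U : cstarType R) (e : U).
Hypotheses (mul1a : forall x : U, e ** x = x) (mula1 : forall x : U, x ** e = x).
Hypothesis (nrm1 : nrm e = 1).
Local Notation sc r := (r%:C *: e).

(** The element [a = |h|^2 + h^2] has norm [2 |h|^2], so a functional norming [a] takes the value
    [|h|^2] on both summands. Hence [f e = 1], and [f (t - x) <= |t - x| <= t] gives positivity. *)
Lemma unital_real_state (h : U) : star h = h -> h != 0 ->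
  exists f : U -> R, [/\ {morph f : x y / x + y},
    forall (r : R) x, f (r%:C *: x) = r * f x, forall x, f x <= nrm x,
    forall x, pos e x -> 0 <= f x & f (h ** h) = nrm h ^+ 2].
Proof.
move=> hh h0; have N0 : 0 < nrm h ^+ 2.
  by rewrite exprn_gt0// lt_def nrm_eq0 h0 nrm_ge0.
set N := nrm h ^+ 2 in N0 *; have hN : nrm (h ** h) = N by rewrite nrm_sa.
set a := sc N + h ** h.
have aa : star a = a by rewrite starD (star_sc mula1) starM hh.
have nN : nrm (sc N) = N by rewrite (nrm_sc nrm1) gtr0_norm.
have aN : nrm a = 2 * N.
  have le : nrm a <= 2 * N.
    by rewrite (le_trans (nrmD _ _))// hN nN; lra.
  have : N <= `|nrm a - N|.
    apply: (pos_sq_bound mul1a mula1 nrm1 hh).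
    have := posB_sa mula1 aa (lexx (nrm a)).
    by rewrite /a opprD addrA -scB.
  rewrite ler_normr => /orP[|h1]; first by lra.
  (* In this case [h^2 = - N], contrary to [|N - h^2| <= N]. *)
  have a0 : nrm a = 0 by have := nrm_ge0 a; lra.
  move: a0 => /eqP; rewrite nrm_eq0 /a addr_eq0 => /eqP hE.
  have := nrm_sc_sq_le mul1a mula1 nrm1 hh; rewrite -/N.
  have -> : sc N - h ** h = sc (N + N) by rewrite scD {3}hE.
  by rewrite (nrm_sc nrm1) gtr0_norm; lra.
have sn : sublinear (@nrm R U).
  by split=> [x y|r x r0]; [exact: nrmD | rewrite nrmZr ger0_norm].
have [f [fD fZ fle fa]] := hahn_banach a sn.
have fN := fle (sc N); have fh := fle (h ** h).
rewrite nN in fN; rewrite hN in fh; rewrite aN fD in fa.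
have [{}fN {}fh] : f (sc N) = N /\ f (h ** h) = N.
  by move: (f (sc N)) (f (h ** h)) fN fh fa => u v; split; lra.
have f1 : f e = 1 by apply: (mulfI (lt0r_neq0 N0)); rewrite -fZ mulr1.
exists f; split=> //.
move=> x [_ [t t0 tx]]; have := le_trans (fle (sc t - x)) tx.
by rewrite -scaleN1r -(rmorphN1 (real_complex R)) fD !fZ f1; lra.
Qed.

End UnitalState.

Section States.
Variables (R : realType) (A : cstarType R).
Hypothesis A_neq0 : exists a : A, a <> 0.
Local Notation e := (mult_one A).
Local Notation emb := (@mult_embed R A).

Let mul1a : forall m : multiplier A, e ** m = m := @mul_mult_one R A.
Let mula1 : forall m : multiplier A, m ** e = m := @mult_one_mul R A.
Let nrm1 : nrm e = 1.
Proof. by have [a /nrm_mult_one] := A_neq0. Qed.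

Lemma mult_embedD (x y : A) : emb (x + y) = emb x + emb y.
Proof. by have := mult_embed_linear 1 x y; rewrite !scale1r. Qed.

Lemma mult_embed0 : emb 0 = 0.
Proof. by apply: nrm0_eq0; rewrite nrm_mult_embed nrm0. Qed.

Lemma mult_embedZ (c : R[i]) (x : A) : emb (c *: x) = c *: emb x.
Proof. by rewrite -[c *: x]addr0 mult_embed_linear mult_embed0 addr0. Qed.

Lemma mult_embedB (x y : A) : emb (x - y) = emb x - emb y.
Proof. by rewrite -scaleN1r mult_embedD mult_embedZ scaleN1r. Qed.

(** A real state of the multiplier algebra is evaluated on real parts and complexified. It takes the
    value [|h|^2] at [h ** h], where [h = k ** k] is a product because the witness must have the
    form [a ** x]. *)
Lemma nonzero_state : exists phi : A -> R[i],
  [/\ linear_for *%R phi, forall x, phi (star x) = (phi x)^*,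
    forall x, 0 <= phi (star x ** x) <= ((nrm x) ^+ 2)%:C &
    exists a x, phi (star (a ** x) ** (a ** x)) != 0].
Proof.
have [a a0] := A_neq0.
pose k := star a ** a; have kk : star k = k by rewrite starM starK.
pose h := k ** k; have hh : star h = h by rewrite starM kk.
have h0 : emb h != 0.
  rewrite -nrm_eq0 nrm_mult_embed nrm_sa// nrm_cstar !expf_eq0 nrm_eq0.
  exact/eqP.
have ehh : star (emb h) = emb h by rewrite -mult_embed_star hh.
have [f [fD fZ fle fpos fh]] := unital_real_state mul1a mula1 nrm1 ehh h0.
pose g x := f ((2^-1 : R)%:C *: emb (x + star x)).
have gD x y : g (x + y) = g x + g y.
  by rewrite /g -fD -scalerDr -mult_embedD starD addrACA.
have gZ (r : R) x : g (r%:C *: x) = r * g x.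
  rewrite /g starZr -scalerDr mult_embedZ scalerA mulrC -scalerA.
  by rewrite fZ.
have gN x : g (- x) = - g x.
  by rewrite -scaleN1r -(rmorphN1 (real_complex R)) gZ mulN1r.
have gs x : g (star x) = g x by rewrite /g starK addrC.
(* The complex-linear functional with real part [g]; it respects [star] because [g] sees only real
   parts. *)
pose phi x : R[i] := (g x)%:C - 'i * (g ('i *: x))%:C.
have phiD x y : phi (x + y) = phi x + phi y.
  by rewrite /phi scalerDr !gD !rmorphD /= mulrDr opprD addrACA.
have phiR (r : R) x : phi (r%:C *: x) = r%:C * phi x.
  rewrite /phi (_ : 'i *: (r%:C *: x) = r%:C *: ('i *: x)); last by rewrite !scalerA mulrC.
  by rewrite !gZ !rmorphM /= mulrBr mulrCA.
have phiI x : phi ('i *: x) = 'i * phi x.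
  rewrite /phi scalerA -expr2 sqrCi scaleN1r gN rmorphN /= mulrN opprK.
  by rewrite mulrBr mulrA -expr2 sqrCi mulN1r opprK addrC.
have phiZ (c : R[i]) x : phi (c *: x) = c * phi x.
  rewrite (Crect c) -complexRe -complexIm scalerDl phiD phiR -scalerA phiI phiR.
  by rewrite mulrDl mulrA.
have phi_sq x : phi (star x ** x) = (f (emb (star x ** x)))%:C.
  rewrite /phi /g starZ starM starK conjCi scaleNr subrr mult_embed0 scaler0.
  rewrite (_ : f 0 = 0); last by have := fD 0 0; rewrite addr0; lra.
  rewrite mulr0 subr0 mult_embedD scalerDr -scalerDl -rmorphD /=.
  by rewrite (_ : 2^-1 + 2^-1 = 1) ?rmorph1 ?scale1r//; lra.
exists phi; split.
- by move=> c x y; rewrite phiD phiZ.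
- move=> x; rewrite /phi gs rmorphB /= rmorphM /= !conj_real conjCi.
  have -> : 'i *: star x = star (- ('i *: x)).
    by rewrite starN starZ conjCi scaleNr opprK.
  by rewrite gs gN rmorphN /= mulrN mulNr.
- move=> x; rewrite phi_sq ler0c lecR fpos ?mult_embedM ?mult_embed_star//=.
    by rewrite (le_trans (fle _))// nrm_cstar nrm_mult_embed.
  exact: pos_star_mul.
- exists k, k; rewrite phi_sq hh mult_embedM fh.
  rewrite (_ : 0 = 0%:C)// (inj_eq (@complexI R)) expf_eq0 nrm_eq0//.
Qed.

(** Let [c = x ** star x] and [N = |x|^2]; then [u = 1 - c / N] is a contraction. The geometric sum
    [s n] of its powers satisfies [s n ** c = N (1 - u^n)], so [|s n ** x|^2 = |s n ** c ** s n| <=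
    2 N n]. Divided by [n], [s n ** x] tends to [0], and it equals [x - a ** x]. *)
Lemma approximate_unit (x : A) (d : R) : 0 < d -> exists a, nrm (x - a ** x) <= d.
Proof.
move=> d0; have [->|x0] := eqVneq x 0.
  by exists 0; rewrite mula0 subrr nrm0 ltW.
set N := nrm x ^+ 2; have N0 : 0 < N by rewrite exprn_gt0// lt_def nrm_eq0 x0 nrm_ge0.
pose c := emb (x ** star x).
have pc : pos e c.
  by rewrite /c -{1}[x]starK mult_embedM mult_embed_star; exact: pos_star_mul.
have nc : nrm c = N.
  by rewrite /c nrm_mult_embed -{1}[x]starK nrm_cstar nrm_star.
pose u := e - N^-1%:C *: c.
have uu : star u = u.
  by rewrite starB starZr (pos_sa pc) star_mult_one.
have u1 : nrm u <= 1.
  have : nrm (N%:C *: e - c) <= N by rewrite -{1 2}nc; exact: nrm_sc_pos_le pc.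
  have -> : u = N^-1%:C *: (N%:C *: e - c).
    by rewrite scalerBr scalerA -rmorphM /= mulVf ?gt_eqF// rmorph1 scale1r.
  by rewrite nrmZr gtr0_norm ?invr_gt0// mulrC ler_pdivrMr// mul1r.
pose s n := \sum_(k < n) upow e u k.
have sS n : s n.+1 = s n + upow e u n by rewrite /s big_ord_recr.
have sn n : nrm (s n) <= n%:R.
  elim: n => [|n IH]; first by rewrite /s big_ord0 nrm0.
  rewrite sS -natr1 (le_trans (nrmD _ _))// lerD//.
  by rewrite (le_trans (nrm_upow_le nrm1 n u1))// expr1n.
have s_sa n : star (s n) = s n.
  elim: n => [|n IH]; first by rewrite /s big_ord0 star0.
  by rewrite sS starD IH (star_upow mul1a mula1).
have sc_ n : s n ** (e - u) = e - upow e u n.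
  elim: n => [|n IH]; first by rewrite /s big_ord0 mul0a subrr.
  rewrite sS amulDl IH amulBr mula1 -(upow_comm mul1a mula1).
  by rewrite -/(upow e u n.+1); zmod.
(* Powers of [u] differ from the unit by elements of [A], which puts [a] in [A]. *)
have emb_pw n : exists b, upow e u n = e - emb b.
  elim: n => [|n [b IH]]; first by exists 0; rewrite mult_embed0 subr0.
  rewrite /upow iterS -/(upow e u n) IH /u /c -mult_embedZ.
  set y := _ *: _; exists (y + b - y ** b).
  rewrite amulBl !amulBr !mul1a mula1 mult_embedB mult_embedD mult_embedM.
  by zmod.
have emb_s n : exists b, s n = n%:R *: e - emb b.
  elim: n => [|n [b IH]].
    by exists 0; rewrite /s big_ord0 scale0r mult_embed0 subrr.
  have [b' E] := emb_pw n; exists (b + b').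
  by rewrite sS IH E -natr1 scalerDl scale1r mult_embedD; zmod.
have bnd n : nrm (s n ** emb x) ^+ 2 <= 2 * N * n%:R.
  have sc2 : nrm (s n ** c) <= 2 * N.
    have -> : s n ** c = N%:C *: (e - upow e u n).
      rewrite -sc_ -amulZr /u opprB addrC subrK scalerA -rmorphM /= mulfV ?gt_eqF//.
      by rewrite rmorph1 scale1r.
    rewrite nrmZr gtr0_norm// mulrC ler_pM2r// (le_trans (nrmB _ _))// nrm1.
    by have := nrm_upow_le nrm1 n u1; rewrite expr1n; lra.
  rewrite -(nrm_star (s n ** _)) -nrm_cstar starK starM s_sa -mult_embed_star.
  rewrite amulA -[s n ** _ ** _]amulA -mult_embedM -/c.
  by rewrite (le_trans (nrm_mul _ _))// ler_pM ?nrm_ge0.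
have [n hn] : exists n : nat, 2 * N < n%:R * d ^+ 2.
  exists (Num.bound `|2 * N / d ^+ 2|).
  rewrite -ltr_pdivrMr ?exprn_gt0//.
  by rewrite (le_lt_trans (ler_norm _))// archi_boundP.
have n0 : 0 < n%:R :> R.
  by rewrite -(pmulr_lgt0 _ (exprn_gt0 2 d0)) (lt_trans _ hn)// mulr_gt0.
have [b sE] := emb_s n; exists ((n%:R^-1 : R)%:C *: b).
have E : n%:R^-1%:C *: (s n ** emb x) = emb (x - (n%:R^-1)%:C *: b ** x).
  rewrite sE amulBl amulZl mul1a scalerBr scalerA amulZl mult_embedB mult_embedZ.
  rewrite mult_embedM -(rmorph_nat (real_complex R)) -rmorphM /= mulVf ?gt_eqF//.
  by rewrite rmorph1 scale1r.
rewrite -nrm_mult_embed -E nrmZr gtr0_norm ?invr_gt0// mulrC ler_pdivrMr//.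
rewrite -(@ler_pXn2r _ 2) ?nnegrE ?nrm_ge0 ?mulr_ge0 ?(ltW d0)//.
rewrite (le_trans (bnd n))// exprMn (expr2 n%:R) mulrA ler_pM2r//.
by rewrite [leRHS]mulrC ltW.
Qed.

End States.

(** * Completion of a pre-Hilbert space *)

Section Semiforms.
Variable R : realType.

Record semiform (E : lmodType R[i]) := Semiform {
  sform :> E -> E -> R[i];
  sformD : forall x y z, sform (x + y) z = sform x z + sform y z;
  sformZ : forall (c : R[i]) x y, sform (c *: x) y = c * sform x y;
  sformC : forall x y, sform x y = (sform y x)^*;
  sform_ge0 : forall x, 0 <= sform x x
}.

Variables (E : lmodType R[i]) (g : semiform E).
Implicit Types (x y z : E) (u v : nat -> E).

Lemma sformDr x y z : g x (y + z) = g x y + g x z.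
Proof. by rewrite sformC sformD rmorphD /= -!sformC. Qed.

Lemma sformZr (c : R[i]) x y : g x (c *: y) = c^* * g x y.
Proof. by rewrite sformC sformZ rmorphM /= -sformC. Qed.

Lemma sform0 x : g 0 x = 0.
Proof. by rewrite -(scale0r (0 : E)) sformZ mul0r. Qed.

Lemma sformN x y : g (- x) y = - g x y.
Proof. by rewrite -scaleN1r sformZ mulN1r. Qed.

Lemma sformNr x y : g x (- y) = - g x y.
Proof. by rewrite -scaleN1r sformZr rmorphN1 mulN1r. Qed.

Lemma sformB x y z : g (x - y) z = g x z - g y z.
Proof. by rewrite sformD sformN. Qed.

Lemma sformBr x y z : g x (y - z) = g x y - g x z.
Proof. by rewrite sformDr sformNr. Qed.

Definition fnorm x : R := Num.sqrt (nrm (g x x)).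

Lemma fnorm_ge0 x : 0 <= fnorm x.
Proof. exact: sqrtr_ge0. Qed.

Lemma sformE x : g x x = (fnorm x ^+ 2)%:C.
Proof. by rewrite sqr_sqrtr ?nrm_ge0// nrmE ger0_norm ?sform_ge0. Qed.

Lemma cauchy_schwarz x y : nrm (g x y) <= fnorm x * fnorm y.
Proof.
set G := g x y; set n := nrm G; have n0 : 0 <= n by apply: nrm_ge0.
set a := fnorm x; set b := fnorm y.
have GG : G * G^* = (n ^+ 2)%:C by rewrite rmorphXn /= nrmE normCK.
(* Nonnegativity of the form at [x - t G y]; the factor [G] makes the cross terms real. *)
have key (t : R) : 0 <= a ^+ 2 - 2 * t * n ^+ 2 + t ^+ 2 * n ^+ 2 * b ^+ 2.
  have := sform_ge0 g (x - (t%:C * G) *: y).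
  rewrite sformB !sformBr !sformZ !sformZr -/G (sformC g y x) -/G !sformE -/a -/b.
  have -> : (t%:C * G)^* = t%:C * G^* by rewrite rmorphM /= conj_real.
  have -> : (a ^+ 2)%:C - t%:C * G^* * G
      - (t%:C * G * G^* - t%:C * G * (t%:C * G^* * (b ^+ 2)%:C)) =
      (a ^+ 2)%:C - 2 * t%:C * (G * G^*) + t%:C ^+ 2 * (G * G^*) * (b ^+ 2)%:C.
    by ring.
  rewrite GG -(rmorph_nat (real_complex R)) -!rmorphXn -!rmorphM -rmorphB -rmorphD.
  by rewrite ler0c.
rewrite -(@ler_pXn2r _ 2) ?nnegrE ?mulr_ge0 ?fnorm_ge0// exprMn.
clearbody n a b; have [b0|b0] := eqVneq (b ^+ 2) 0.
  rewrite b0 mulr0; rewrite leNgt; apply/negP => n2.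
  (* When [y] has norm [0] the polynomial is affine in [t], and this [t] gives it the value [-1]. *)
  have := key ((a ^+ 2 + 1) / (2 * n ^+ 2)); rewrite b0 mulr0 addr0.
  have -> : 2 * ((a ^+ 2 + 1) / (2 * n ^+ 2)) * n ^+ 2 = a ^+ 2 + 1.
    by field; apply: contraTneq n2 => ->; rewrite expr0n ltxx.
  lra.
have b1 : 0 < b ^+ 2 by rewrite lt_def b0 sqr_ge0.
have := key (b ^+ 2)^-1.
have -> : a ^+ 2 - 2 * (b ^+ 2)^-1 * n ^+ 2 + (b ^+ 2)^-1 ^+ 2 * n ^+ 2 * b ^+ 2 =
    a ^+ 2 - n ^+ 2 / b ^+ 2.
  by field; rewrite -sqrf_eq0.
by rewrite subr_ge0 ler_pdivrMr.
Qed.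

Lemma fnormZ (c : R[i]) x : fnorm (c *: x) = nrm c * fnorm x.
Proof.
rewrite /fnorm sformZ sformZr !nrmM nrm_conj mulrA -expr2.
by rewrite sqrtrM ?sqr_ge0// sqrtr_sqr ger0_norm ?nrm_ge0.
Qed.

Lemma fnormD x y : fnorm (x + y) <= fnorm x + fnorm y.
Proof.
rewrite -(@ler_pXn2r _ 2) ?nnegrE ?addr_ge0 ?fnorm_ge0//.
have -> : fnorm (x + y) ^+ 2 = complex.Re (g (x + y) (x + y)).
  by rewrite sformE.
rewrite sformD !sformDr !sformE !raddfD /=.
have := cauchy_schwarz x y; have := cauchy_schwarz y x.
have := ler_norm (complex.Re (g x y)); have := ler_norm (complex.Re (g y x)).
have := Re_le_nrm (g x y); have := Re_le_nrm (g y x).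
by rewrite sqrrD; lra.
Qed.

Definition fcauchy u : Prop := forall e : R, 0 < e ->
  exists N, forall m n, (N <= m)%N -> (N <= n)%N -> fnorm (u m - u n) <= e.

Lemma fcauchyD u v : fcauchy u -> fcauchy v -> fcauchy (fun n => u n + v n).
Proof.
move=> cu cv e e0; have e20 : 0 < e / 2 by lra.
have [N uN] := cu _ e20; have [M vM] := cv _ e20.
exists (maxn N M) => m n; rewrite !geq_max => /andP[Nm Mm] /andP[Nn Mn].
rewrite opprD addrACA (le_trans (fnormD _ _))//.
by have := uN _ _ Nm Nn; have := vM _ _ Mm Mn; lra.
Qed.

Lemma fcauchy_map (f : E -> E) (C : R) u :
  (forall x y, fnorm (f x - f y) <= C * fnorm (x - y)) ->
  fcauchy u -> fcauchy (f \o u).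
Proof.
move=> fC cu e e0; have C0 : 0 < `|C| + 1 by rewrite ltr_wpDl.
have [|N uN] := cu (e / (`|C| + 1)); first by rewrite divr_gt0.
exists N => m n Nm Nn; have := uN m n Nm Nn.
rewrite ler_pdivlMr// => h; apply: le_trans h.
rewrite (le_trans (fC _ _))// mulrC ler_wpM2l ?fnorm_ge0//.
by rewrite (le_trans (ler_norm _))// lerDl.
Qed.

Lemma fcauchy_bounded u : fcauchy u -> exists2 M : R, 0 < M &
  exists N, forall n, (N <= n)%N -> fnorm (u n) <= M.
Proof.
move=> /(_ 1 ltr01)[N uN]; exists (fnorm (u N) + 1).
  by rewrite ltr_wpDl ?fnorm_ge0.
exists N => n Nn; have := fnormD (u n - u N) (u N); rewrite subrK.
by have := uN n N Nn (leqnn N); lra.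
Qed.

Lemma sform_cauchy u v : fcauchy u -> fcauchy v ->
  cauchy_seq (fun n => g (u n) (v n)).
Proof.
move=> cu cv e e0.
have [M M0 [N uM]] := fcauchy_bounded cu.
have [M' M'0 [N' vM]] := fcauchy_bounded cv.
have [|P uP] := cu (e / (2 * M')); first by rewrite divr_gt0 ?mulr_gt0.
have [|Q vQ] := cv (e / (2 * M)); first by rewrite divr_gt0 ?mulr_gt0.
exists (maxn (maxn N N') (maxn P Q)) => m n.
rewrite !geq_max => /andP[/andP[Nm N'm] /andP[Pm Qm]] /andP[/andP[Nn N'n] /andP[Pn Qn]].
have -> : g (u m) (v m) - g (u n) (v n) = g (u m - u n) (v m) + g (u n) (v m - v n).
  by rewrite sformB sformBr; zmod.
rewrite (le_trans (nrmD _ _))//.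
have h1 : nrm (g (u m - u n) (v m)) <= e / (2 * M') * M'.
  by rewrite (le_trans (cauchy_schwarz _ _))// ler_pM ?fnorm_ge0 ?uP ?vM.
have h2 : nrm (g (u n) (v m - v n)) <= M * (e / (2 * M)).
  by rewrite (le_trans (cauchy_schwarz _ _))// ler_pM ?fnorm_ge0 ?vQ ?uM.
have -> : e = e / (2 * M') * M' + M * (e / (2 * M)).
  by field; rewrite !gt_eqF.
exact: lerD.
Qed.

(** Split [g (u n) (u n)] at a fixed late term [u N]: Cauchy-Schwarz controls one part, weak
    convergence the other. Consequently a functional determines its Cauchy sequence up to null
    sequences. *)
Lemma fcauchy_weak0 u : fcauchy u -> (forall y, tends (fun n => g (u n) y) 0) ->
  forall e : R, 0 < e -> exists N, forall n, (N <= n)%N -> fnorm (u n) <= e.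
Proof.
move=> cu u0 e e0.
have [|N uN] := cu (e / 2); first by lra.
have [|M uM] := u0 (u N) (e ^+ 2 / 2); first by rewrite divr_gt0 ?exprn_gt0.
exists (maxn N M) => n; rewrite geq_max => /andP[Nn /uM].
rewrite subr0 => h1; have h2 := uN n N Nn (leqnn N).
rewrite leNgt; apply/negP => h3.
have E2 : fnorm (u n) ^+ 2 = nrm (g (u n) (u n)) by rewrite sqr_sqrtr ?nrm_ge0.
have h4 : nrm (g (u n) (u n)) <= nrm (g (u n) (u n - u N)) + nrm (g (u n) (u N)).
  by rewrite (le_trans _ (nrmD _ _))// -sformDr subrK.
have h5 := cauchy_schwarz (u n) (u n - u N).
have h6 : fnorm (u n) * fnorm (u n - u N) <= fnorm (u n) * (e / 2).
  by rewrite ler_wpM2l ?fnorm_ge0.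
nra.
Qed.

End Semiforms.

Section Completion.
Variables (R : realType) (E : lmodType R[i]) (g : semiform E).
Implicit Types (x y z : E) (u v : nat -> E).

Definition represents u (phi : E -> R[i]) : Prop :=
  fcauchy g u /\ forall y, tends (fun n => g (u n) y) (phi y).

(* A class of Cauchy sequences [u] is encoded by the antilinear functional    *)
(* [lim g (u n) _] that it defines.                                           *)
Record hcompl := Hcompl {
  hfun :> E -> R[i];
  hfunP : exists u, represents u hfun
}.

Lemma hcompl_eq (p q : hcompl) : p =1 q -> p = q.
Proof.
case: p q => [p hp] [q hq] /= /funext pq; rewrite -{}pq in hq *.
by congr Hcompl; exact: Prop_irrelevance.
Qed.

Lemma tends_scal (c : R[i]) (w : nat -> R[i]) l :
  tends w l -> tends (fun n => c * w n) (c * l).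
Proof.
apply: (@tends_bounded_map _ _ _ ( *%R c) (nrm c)) => x.
by rewrite -mulrBr nrmM.
Qed.

Lemma represents0 : represents (fun=> 0) (fun=> 0).
Proof.
split=> [e e0|y]; first by exists 0%N => *; rewrite subrr /fnorm sform0 nrm0 sqrtr0 ltW.
by rewrite sform0; exact: tends_cst.
Qed.

Lemma representsD u v phi psi : represents u phi -> represents v psi ->
  represents (fun n => u n + v n) (fun y => phi y + psi y).
Proof.
move=> [cu uphi] [cv vpsi]; split; first exact: fcauchyD.
move=> y; under [X in tends X]eq_fun do rewrite sformD.
exact: tendsD.
Qed.

Lemma representsZ (c : R[i]) u phi : represents u phi ->
  represents (fun n => c *: u n) (fun y => c * phi y).
Proof.
move=> [cu uphi]; split.
  apply: (fcauchy_map (f := *:%R c) (C := nrm c) _ cu) => x y.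
  by rewrite -scalerBr fnormZ.
move=> y; under [X in tends X]eq_fun do rewrite sformZ.
exact: tends_scal.
Qed.

Lemma hzero_subproof : exists u, represents u (fun=> 0).
Proof. by exists (fun=> 0); exact: represents0. Qed.

Definition hzero : hcompl := Hcompl hzero_subproof.

Lemma hadd_subproof (p q : hcompl) : exists u, represents u (fun y => p y + q y).
Proof.
have [u up] := hfunP p; have [v vq] := hfunP q.
by exists (fun n => u n + v n); exact: representsD.
Qed.

Definition hadd (p q : hcompl) : hcompl := Hcompl (hadd_subproof p q).

Lemma hscale_subproof (c : R[i]) (p : hcompl) :
  exists u, represents u (fun y => c * p y).
Proof.
by have [u up] := hfunP p; exists (fun n => c *: u n); exact: representsZ.
Qed.

Definition hscale (c : R[i]) (p : hcompl) : hcompl := Hcompl (hscale_subproof c p).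

HB.instance Definition _ := gen_eqMixin hcompl.
HB.instance Definition _ := gen_choiceMixin hcompl.

Fact haddA : associative hadd.
Proof. by move=> p q r; apply: hcompl_eq => y /=; rewrite addrA. Qed.
Fact haddC : commutative hadd.
Proof. by move=> p q; apply: hcompl_eq => y /=; rewrite addrC. Qed.
Fact hadd0 : left_id hzero hadd.
Proof. by move=> p; apply: hcompl_eq => y /=; rewrite add0r. Qed.
Fact haddN : left_inverse hzero (hscale (-1)) hadd.
Proof. by move=> p; apply: hcompl_eq => y /=; rewrite mulN1r addNr. Qed.

HB.instance Definition _ :=
  GRing.isZmodule.Build hcompl haddA haddC hadd0 haddN.

Fact hscaleA (a b : R[i]) p : hscale a (hscale b p) = hscale (a * b) p.
Proof. by apply: hcompl_eq => y /=; rewrite mulrA. Qed.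
Fact hscale1 : left_id 1 hscale.
Proof. by move=> p; apply: hcompl_eq => y /=; rewrite mul1r. Qed.
Fact hscaleDr : right_distributive hscale +%R.
Proof. by move=> a p q; apply: hcompl_eq => y /=; rewrite mulrDr. Qed.
Fact hscaleDl p : {morph hscale^~ p : a b / a + b}.
Proof. by move=> a b; apply: hcompl_eq => y /=; rewrite mulrDl. Qed.

HB.instance Definition _ :=
  GRing.Zmodule_isLmodule.Build R[i] hcompl hscaleA hscale1 hscaleDr hscaleDl.

Lemma hfunD (p q : hcompl) y : (p + q) y = p y + q y. Proof. by []. Qed.
Lemma hfunZ (c : R[i]) (p : hcompl) y : (c *: p) y = c * p y. Proof. by []. Qed.
Lemma hfunB (p q : hcompl) y : (p - q) y = p y - q y.
Proof. by rewrite hfunD -scaleN1r hfunZ mulN1r. Qed.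

Definition hrep (p : hcompl) : nat -> E := projT1 (cid (hfunP p)).

Lemma hrepP p : represents (hrep p) p.
Proof. exact: (projT2 (cid (hfunP p))). Qed.

(** A limit along chosen representatives; independence of the choice is [hdotP]. *)
Definition hdot (p q : hcompl) : R[i] :=
  projT1 (cid (complex_complete (sform_cauchy (hrepP p).1 (hrepP q).1))).

Lemma hrepD p q : represents (fun n => hrep p n + hrep q n) (p + q : hcompl).
Proof. exact: representsD (hrepP p) (hrepP q). Qed.

Lemma hrepZ (c : R[i]) p : represents (fun n => c *: hrep p n) (c *: p : hcompl).
Proof. exact: representsZ (hrepP p). Qed.

Lemma represents_diff u u' phi : represents u phi -> represents u' phi ->
  forall e : R, 0 < e -> exists N, forall n, (N <= n)%N -> fnorm g (u n - u' n) <= e.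
Proof.
move=> hu hu'; have hN := representsD hu (representsZ (-1) hu').
move=> e e0; have [|N HN] := fcauchy_weak0 hN.1 _ e0.
  by move=> y; have := hN.2 y; rewrite mulN1r subrr.
by exists N => n /HN; rewrite scaleN1r.
Qed.

Lemma hdotP u v (p q : hcompl) : represents u p -> represents v q ->
  tends (fun n => g (u n) (v n)) (hdot p q).
Proof.
move=> up vq; rewrite /hdot; case: cid => l /= hl.
have [l' hl'] := complex_complete (sform_cauchy up.1 vq.1).
suff -> : l = l' by [].
set u' := hrep p in hl; set v' := hrep q in hl.
have pp := represents_diff up (hrepP p); have qq := represents_diff vq (hrepP q).
have [M M0 [N uM]] := fcauchy_bounded up.1.
have [M' M'0 [N' vM]] := fcauchy_bounded (hrepP q).1.
apply: tends_uniq hl _ => e e0.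
have e2 : 0 < e / 2 by lra.
have [P lP] := hl' _ e2.
have [|Q uQ] := pp (e / (4 * M')); first by rewrite divr_gt0 ?mulr_gt0.
have [|S vS] := qq (e / (4 * M)); first by rewrite divr_gt0 ?mulr_gt0.
exists (maxn (maxn N N') (maxn P (maxn Q S))) => n.
rewrite !geq_max => /andP[/andP[/uM Nn /vM N'n] /and3P[/lP Pn /uQ Qn /vS Sn]].
have -> : g (u' n) (v' n) - l' =
  (g (u n) (v n) - l') - (g (u n - u' n) (v' n) + g (u n) (v n - v' n)).
  by rewrite sformB sformBr; zmod.
have h1 : nrm (g (u n - u' n) (v' n)) <= e / (4 * M') * M'.
  by rewrite (le_trans (cauchy_schwarz _ _ _))// ler_pM ?fnorm_ge0.
have h2 : nrm (g (u n) (v n - v' n)) <= M * (e / (4 * M)).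
  by rewrite (le_trans (cauchy_schwarz _ _ _))// ler_pM ?fnorm_ge0.
have E1 : e / (4 * M') * M' = e / 4 by field; rewrite gt_eqF.
have E2 : M * (e / (4 * M)) = e / 4 by field; rewrite gt_eqF.
rewrite E1 in h1; rewrite E2 in h2; rewrite (le_trans (nrmB _ _))//.
have := nrmD (g (u n - u' n) (v' n)) (g (u n) (v n - v' n)); lra.
Qed.

Fact hdotD p q r : hdot (p + q) r = hdot p r + hdot q r.
Proof.
have h := hdotP (hrepD p q) (hrepP r).
apply: tends_uniq_ext h (tendsD (hdotP (hrepP p) (hrepP r)) (hdotP (hrepP q) (hrepP r))).
by move=> n; rewrite sformD.
Qed.

Fact hdotZ (c : R[i]) p q : hdot (c *: p) q = c * hdot p q.
Proof.
apply: tends_uniq_ext (hdotP (hrepZ c p) (hrepP q))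
  (tends_scal c (hdotP (hrepP p) (hrepP q))).
by move=> n; rewrite sformZ.
Qed.

Lemma tends_conj (w : nat -> R[i]) l : tends w l -> tends (fun n => (w n)^*) (l^*).
Proof.
apply: (@tends_bounded_map _ _ _ (@Num.conj R[i]) 1) => x.
by rewrite -rmorphB nrm_conj mul1r.
Qed.

Fact hdotC p q : hdot p q = (hdot q p)^*.
Proof.
apply: tends_uniq_ext (hdotP (hrepP p) (hrepP q))
  (tends_conj (hdotP (hrepP q) (hrepP p))).
by move=> n; rewrite sformC.
Qed.

Fact hdot_ge0 p : 0 <= hdot p p.
Proof.
have pr : hdot p p \is Num.real by apply/CrealP; rewrite -hdotC.
rewrite -(RRe_real pr) ler0c.
rewrite -oppr_le0; apply: le_eps0 => e /(hdotP (hrepP p) (hrepP p))[N /(_ N (leqnn N))].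
set x := hrep p N; rewrite sformE => h.
have := Re_le_nrm ((fnorm g x ^+ 2)%:C - hdot p p).
rewrite raddfB /=; have := ler_norm (fnorm g x ^+ 2 - complex.Re (hdot p p)).
have := sqr_ge0 (fnorm g x); lra.
Qed.

Definition hform : semiform hcompl := Semiform hdotD hdotZ hdotC hdot_ge0.

Lemma represents_cst x : represents (fun=> x) (g x).
Proof.
split=> [e e0|y]; last exact: tends_cst.
by exists 0%N => *; rewrite subrr /fnorm sform0 nrm0 sqrtr0 ltW.
Qed.

Lemma hinj_subproof x : exists u, represents u (g x).
Proof. by exists (fun=> x); exact: represents_cst. Qed.

Definition hinj x : hcompl := Hcompl (hinj_subproof x).

Lemma represents_hinj x : represents (fun=> x) (hinj x).
Proof. exact: represents_cst. Qed.

Lemma hdot_inj (p : hcompl) y : hdot p (hinj y) = p y.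
Proof.
exact: tends_uniq (hdotP (hrepP p) (represents_hinj y)) ((hrepP p).2 y).
Qed.

Lemma hinjE x y : hinj x y = g x y. Proof. by []. Qed.

Fact hnorm_eq0 (p : hcompl) : (fnorm hform p)%:C = 0 -> p = 0.
Proof.
move=> /(@complexI R) p0; apply: hcompl_eq => y; apply: nrm0_eq0.
rewrite -hdot_inj (le_trans (cauchy_schwarz hform p (hinj y)))//.
by rewrite p0 mul0r.
Qed.

Fact hnormD (p q : hcompl) :
  (fnorm hform (p + q))%:C <= (fnorm hform p)%:C + (fnorm hform q)%:C.
Proof. by rewrite -rmorphD lecR fnormD. Qed.

Fact hnormZ (c : R[i]) (p : hcompl) :
  (fnorm hform (c *: p))%:C = `|c| * (fnorm hform p)%:C.
Proof. by rewrite fnormZ rmorphM /= nrmE. Qed.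

HB.instance Definition _ := Lmodule_isNormed.Build R[i] hcompl
  hnormD hnormZ hnorm_eq0.

Lemma nrm_hcompl (p : hcompl) : nrm p = fnorm hform p.
Proof. by []. Qed.

Lemma nrm_hinj x : nrm (hinj x) = fnorm g x.
Proof. by rewrite nrm_hcompl /fnorm /= hdot_inj. Qed.

Lemma hinjD x y : hinj (x + y) = hinj x + hinj y.
Proof. by apply: hcompl_eq => z; rewrite /= sformD. Qed.

Lemma hinjZ (c : R[i]) x : hinj (c *: x) = c *: hinj x.
Proof. by apply: hcompl_eq => z; rewrite /= sformZ. Qed.

Lemma hinjB x y : hinj (x - y) = hinj x - hinj y.
Proof. by rewrite -scaleN1r hinjD hinjZ scaleN1r. Qed.

Lemma nrm_represents_le u (p : hcompl) (M : R) N : 0 <= M -> represents u p ->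
  (forall n, (N <= n)%N -> fnorm g (u n) <= M) -> nrm p <= M.
Proof.
move=> M0 up uM; rewrite -(@ler_pXn2r _ 2) ?nnegrE ?nrm_ge0//.
rewrite nrm_hcompl sqr_sqrtr ?nrm_ge0//.
apply: (tends_le (N := N) (hdotP up up)) => n Nn.
rewrite sformE nrmr ger0_norm ?sqr_ge0//.
by rewrite ler_pXn2r ?nnegrE ?fnorm_ge0// uM.
Qed.

Lemma represents_tends u (p : hcompl) : represents u p -> tends (hinj \o u) p.
Proof.
move=> up e e0; have [N uN] := up.1 e e0; exists N => n Nn.
have h := representsD (represents_cst (u n)) (representsZ (-1) up).
have hw := ex_intro (fun w => represents w _) _ h.
have -> : hinj (u n) - p = Hcompl hw.
  by apply: hcompl_eq => y; rewrite hfunB /= mulN1r.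
have {}h : represents _ (Hcompl hw) := h.
apply: (nrm_represents_le (N := N) (ltW e0) h) => m Nm.
by rewrite scaleN1r uN.
Qed.

Lemma hinj_dense (p : hcompl) (e : R) : 0 < e -> exists x, nrm (p - hinj x) <= e.
Proof.
move=> /(represents_tends (hrepP p))[N /(_ N (leqnn N))] h.
by exists (hrep p N); rewrite nrmBC.
Qed.

(** Diagonal argument: vectors [x n] of [E] within [1 / (n + 1)] of [P n] form a Cauchy sequence,
    and the functional it represents is the limit. *)
Lemma hcompl_seq_complete (P : nat -> hcompl) :
  cauchy_seq P -> exists l, tends P l.
Proof.
move=> cP.
have /choice[x xP] n : exists x, nrm (P n - hinj x) <= n.+1%:R^-1.
  by apply: hinj_dense; rewrite invr_gt0.
have small (e : R) : 0 < e -> exists N, forall n, (N <= n)%N ->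
    nrm (P n - hinj (x n)) <= e.
  have /cvgrPdist_le hR := @cvg_harmonic R.
  move=> /hR[N _ HN]; exists N => n /HN; rewrite /= add0r normrN ger0_norm//.
  exact: le_trans.
have cx : fcauchy g x.
  move=> e e0; have e3 : 0 < e / 3 by lra.
  have [N HN] := small _ e3; have [M HM] := cP _ e3.
  exists (maxn N M) => m n; rewrite !geq_max => /andP[/HN Nm Mm] /andP[/HN Nn Mn].
  rewrite -nrm_hinj hinjB; have h := HM m n Mm Mn.
  have := nrm_tri (hinj (x m)) (P m) (hinj (x n)).
  have := nrm_tri (P m) (P n) (hinj (x n)).
  by rewrite (nrmBC (hinj (x m)) (P m)); lra.
have /choice[phi hphi] y := complex_complete (sform_cauchy cx (represents_cst y).1).
have xphi : represents x phi by split.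
pose p := Hcompl (ex_intro (represents ^~ phi) _ xphi).
have xp : tends (hinj \o x) p by exact: represents_tends.
exists p => e e0; have e2 : 0 < e / 2 by lra.
have [N HN] := small _ e2; have [M HM] := xp _ e2.
exists (maxn N M) => n; rewrite !geq_max => /andP[/HN Nn /HM /= Mn].
by have := nrm_tri (P n) (hinj (x n)) p; lra.
Qed.

HB.instance Definition _ := Uniform_isComplete.Build hcompl
  (tends_complete hcompl_seq_complete).

Fact hdot_norm (p : hcompl) : hdot p p = `|p| ^+ 2.
Proof. by rewrite -nrmE -rmorphXn /= nrm_hcompl -sformE. Qed.

HB.instance Definition _ := CompleteNormedModule_isHilbert.Build R hcompl
  hdotD hdotZ hdotC hdot_norm.

End Completion.

(** * Bounded adjointable maps on the completion *)

Section Lifting.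
Variables (R : realType) (E : lmodType R[i]) (g : semiform E).
Implicit Types (x y z : E).

Record adjointable := Adjointable {
  fwd : E -> E;
  bwd : E -> E;
  fwd_linear : linear fwd;
  bwd_linear : linear bwd;
  fwd_bounded : exists2 C : R, 0 <= C & forall x, fnorm g (fwd x) <= C * fnorm g x;
  bwd_bounded : exists2 C : R, 0 <= C & forall x, fnorm g (bwd x) <= C * fnorm g x;
  fwd_bwd : forall x y, g (fwd x) y = g x (bwd y)
}.

Lemma hfun_antilinear (p : hcompl g) (c : R[i]) x y :
  p (c *: x + y) = c^* * p x + p y.
Proof.
have [u [_ up]] := hfunP p.
apply: tends_uniq_ext (up _) (tendsD (tends_scal c^* (up x)) (up y)) => n.
by rewrite sformDr sformZr.
Qed.

Section Map.
Variables (f f' : E -> E) (C : R).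
Hypotheses (f_lin : linear f) (C0 : 0 <= C).
Hypothesis (fC : forall x, fnorm g (f x) <= C * fnorm g x).
Hypothesis (ff' : forall x y, g (f x) y = g x (f' y)).

Lemma represents_map u (phi : E -> R[i]) :
  represents g u phi -> represents g (f \o u) (phi \o f').
Proof.
move=> [cu up]; split.
  apply: (fcauchy_map (C := C) _ cu) => x y.
  have -> : f x - f y = f (x - y); last exact: fC.
  by have := f_lin (-1) y x; rewrite !scaleN1r [- y + x]addrC [RHS]addrC => ->.
move=> y; rewrite (_ : (fun n => _) = fun n => g (u n) (f' y)); first exact: up.
by apply/funext => n /=; rewrite ff'.
Qed.

Lemma hmap_subproof (p : hcompl g) : exists u, represents g u (p \o f').
Proof.
by have [u up] := hfunP p; exists (f \o u); exact: represents_map.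
Qed.

(** On [hinj x], precomposition with the formal adjoint gives [g x (f' y) = g (f x) y], so this is
    the extension of [f]. *)
Definition hmap (p : hcompl g) : hcompl g := Hcompl (hmap_subproof p).

Lemma nrm_hmap p : nrm (hmap p) <= C * nrm p.
Proof.
apply: (@le_epsP _ _ _ C) => e e0 _; rewrite -mulrDr.
have [N HN] := represents_tends (hrepP p) e0.
have h : represents g _ (hmap p) := represents_map (hrepP p).
have pe : 0 <= nrm p + e by rewrite addr_ge0 ?nrm_ge0// ltW.
apply: (nrm_represents_le (N := N) (mulr_ge0 C0 pe) h) => n Nn /=.
rewrite (le_trans (fC _))// ler_wpM2l// -nrm_hinj.
by rewrite (le_trans (nrm_triD _ p))// lerD2l; exact: HN.
Qed.

Lemma hmap_linear : linear hmap.
Proof. by move=> c p q; apply: hcompl_eq. Qed.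

Lemma hmap_bounded : bounded_map hmap.
Proof.
exists C%:C; first by rewrite ler0c.
by move=> p; rewrite -!nrmE -rmorphM lecR nrm_hmap.
Qed.

End Map.

Section Lift.
Variable T : adjointable.

Lemma bwd_fwd x y : g (bwd T x) y = g x (fwd T y).
Proof. by rewrite sformC -fwd_bwd -sformC. Qed.

Let C1 := projT1 (cid2 (fwd_bounded T)).
Let C1_ge0 : 0 <= C1. Proof. by rewrite /C1; case: cid2. Qed.
Let C1P x : fnorm g (fwd T x) <= C1 * fnorm g x.
Proof. by rewrite /C1; case: cid2. Qed.
Let C2 := projT1 (cid2 (bwd_bounded T)).
Let C2_ge0 : 0 <= C2. Proof. by rewrite /C2; case: cid2. Qed.
Let C2P x : fnorm g (bwd T x) <= C2 * fnorm g x.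
Proof. by rewrite /C2; case: cid2. Qed.

Let hT := hmap (fwd_linear T) C1P (fwd_bwd T).
Let hT' := hmap (bwd_linear T) C2P bwd_fwd.

Lemma hlift_adjP (p q : hcompl g) : dot (hT p) q = dot p (hT' q).
Proof.
have hp : represents g _ (hT p) :=
  represents_map (fwd_linear T) C1P (fwd_bwd T) (hrepP p).
have hq : represents g _ (hT' q) :=
  represents_map (bwd_linear T) C2P bwd_fwd (hrepP q).
apply: tends_uniq_ext (hdotP hp (hrepP q)) (hdotP (hrepP p) hq) => n.
exact: fwd_bwd.
Qed.

Definition hlift : boundedop (hcompl g) := BoundedOp
  (hmap_linear (fwd_linear T) C1P (fwd_bwd T))
  (hmap_linear (bwd_linear T) C2P bwd_fwd)
  (hmap_bounded (fwd_linear T) C1_ge0 C1P (fwd_bwd T))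
  (hmap_bounded (bwd_linear T) C2_ge0 C2P bwd_fwd)
  hlift_adjP.

Lemma hliftE p y : bop hlift p y = p (bwd T y). Proof. by []. Qed.
Lemma hlift_starE p y : bop (star hlift) p y = p (fwd T y). Proof. by []. Qed.

Lemma hlift_inj x : bop hlift (hinj g x) = hinj g (fwd T x).
Proof. by apply: hcompl_eq => y; rewrite hliftE !hinjE fwd_bwd. Qed.

End Lift.
End Lifting.

(** * Representations by shifts *)

Section Contractive.
Variables (R : realType) (A : cstarType R) (E : lmodType R[i]) (g : semiform E).
Variable pi : A -> E -> E.
Hypothesis piD : forall a b x, pi (a + b) x = pi a x + pi b x.
Hypothesis piZ : forall (c : R[i]) a x, pi (c *: a) x = c *: pi a x.
Hypothesis piM : forall a b x, pi (a ** b) x = pi a (pi b x).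
Hypothesis piS : forall a x y, g (pi a x) y = g x (pi (star a) y).

(* If [|a| < 1] then [1 - star a ** a] is a square [(1 - y)^2], so            *)
(* [|x|^2 - |pi a x|^2 = |x - pi y x|^2 >= 0].                                *)
Lemma star_rep_contractive a x : fnorm g (pi a x) <= nrm a * fnorm g x.
Proof.
have piN b z : pi (- b) z = - pi b z by rewrite -[- b]scaleN1r piZ scaleN1r.
have key b : nrm b < 1 -> fnorm g (pi b x) <= fnorm g x.
  move=> b1; have [||y [yy yc _ _]] := @cstar_sqrt _ _ (star b ** b).
  - by rewrite starM starK.
  - by rewrite nrm_cstar expr_lt1// nrm_ge0.
  have := sform_ge0 g (x - pi y x).
  have -> : g (x - pi y x) (x - pi y x) = g x x - g (pi b x) (pi b x).
    rewrite [in RHS]piS -piM -yc !piD piN piM !sformDr !sformNr !sformB.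
    rewrite !piS yy.
    by zmod.
  rewrite !sformE -rmorphB ler0c subr_ge0 ler_pXn2r ?nnegrE ?fnorm_ge0//.
apply: (@le_epsP _ _ _ (fnorm g x)) => e e0 _.
rewrite [_ * e]mulrC -mulrDl; set s := nrm a + e.
have s0 : 0 < s by rewrite ltr_wpDl ?nrm_ge0.
have := key (s^-1%:C *: a); rewrite nrmZr gtr0_norm ?invr_gt0//.
rewrite mulrC ltr_pdivrMr// mul1r ltrDl => /(_ e0).
by rewrite piZ fnormZ nrmr gtr0_norm ?invr_gt0// mulrC ler_pdivrMr// mulrC.
Qed.

End Contractive.

Section FiniteSupport.
Variables (R : realType) (A : cstarType R) (I : choiceType).

Definition finsupp_pred : {pred I -> A} :=
  fun f => `[< exists s : seq I, forall i, i \notin s -> f i = 0 >].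

Fact finsupp_closed : submod_closed finsupp_pred.
Proof.
split=> [|c f h /asboolP[s fs] /asboolP[t ht]]; first by apply/asboolP; exists [::].
apply/asboolP; exists (s ++ t) => i; rewrite mem_cat negb_or => /andP[/fs fi /ht hi].
by rewrite /GRing.add /= /GRing.scale /= fi hi scaler0 addr0.
Qed.

HB.instance Definition _ := GRing.isSubmodClosed.Build R[i] (I -> A) finsupp_pred
  finsupp_closed.

Record finsupp := Finsupp { fsval :> I -> A; fsvalP : fsval \in finsupp_pred }.
HB.instance Definition _ := [isSub for fsval].
HB.instance Definition _ := [Choice of finsupp by <:].
HB.instance Definition _ := [SubChoice_isSubLmodule of finsupp by <:].
End FiniteSupport.

(** * Covariance from a single coisometry *)

Section Coisometry.
Variables (R : realType) (A T : starAlgType R) (alpha : A -> A) (pi : A -> T).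
Variables (e w : T).
Hypotheses (mul1a : forall x : T, e ** x = x) (mula1 : forall x : T, x ** e = x).
Hypothesis alpha_star : forall a, alpha (star a) = star (alpha a).
Hypothesis pi_star : forall a, pi (star a) = star (pi a).
Hypothesis ww : w ** star w = e.
Hypothesis wpi : forall a, pi (alpha a) ** w = w ** pi a.

Definition powers n := iter n (amul w) e.

Lemma powersD m n : powers (m + n) = powers m ** powers n.
Proof.
by elim: m => [|m IH]; rewrite ?mul1a// addSn /powers !iterS -/(powers _) IH amulA.
Qed.

Lemma powers_coisometry n : powers n ** star (powers n) = e.
Proof.
have ee : star e = e by rewrite -[LHS]mula1 -{2}[e]starK -starM mula1 starK.
elim: n => [|n IH]; first by rewrite /powers /= mul1a.
rewrite /powers iterS -/(powers n) starM amulA -[w ** _ ** _]amulA IH mula1.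
exact: ww.
Qed.

Lemma powers_intertwine n a :
  pi (iter n alpha a) ** powers n = powers n ** pi a.
Proof.
elim: n => [|n IH]; first by rewrite /powers /= mul1a mula1.
by rewrite iterS /powers iterS -/(powers n) amulA wpi -!amulA IH.
Qed.

Lemma powers_piso : piso_representation powers.
Proof.
split; last exact: powersD.
by move=> n; rewrite /partial_isometry powers_coisometry mul1a.
Qed.

(** The first identity is [powers_intertwine] multiplied on the right by the adjoint power; the
    second combines that relation with its adjoint. *)
Lemma powers_covariant : Defs.covariance alpha pi powers.
Proof.
move=> a n; split.
  by rewrite -powers_intertwine -amulA powers_coisometry mula1.
rewrite -amulA -powers_intertwine !amulA; congr (_ ** _).
have alpha_n b : iter n alpha (star b) = star (iter n alpha b).
  by elim: (n) => // k IH; rewrite !iterS IH alpha_star.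
rewrite -[pi (iter n alpha a)]starK -pi_star -starM -alpha_n.
by rewrite powers_intertwine starM pi_star starK.
Qed.

End Coisometry.

Section Closure.
Variables (R : realType) (V : normedModType R[i]).
Implicit Types (S : set V) (x y : V).

Lemma closure_nrm S x :
  (forall e : R, 0 < e -> exists2 y, S y & nrm (x - y) <= e) -> closure S x.
Proof.
move=> H B /nbhs_ballP[e /= e0 eB].
have er : e = (complex.Re e)%:C by rewrite RRe_real// gtr0_real.
have e1 : 0 < complex.Re e by rewrite -(ltcR 0) -er.
have [|y Sy xy] := H (complex.Re e / 2); first by lra.
exists y; split=> //; apply: eB; rewrite -ball_normE /= er -nrmE ltcR.
by lra.
Qed.

Lemma nrm_closure S x (e : R) : closure S x -> 0 < e ->
  exists2 y, S y & nrm (x - y) <= e.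
Proof.
move=> Sx e0; have e1 : 0 < e%:C :> R[i] by rewrite ltcR.
have [y [Sy]] := Sx _ (nbhsx_ballx x _ e1).
by rewrite -ball_normE /= -nrmE ltcR => /ltW; exists y.
Qed.

Lemma lin_spanD S x y : lin_span S x -> lin_span S y -> lin_span S (x + y).
Proof.
move=> [m [c [s [Ss ->]]]] [n [d [t [St ->]]]].
exists (m + n)%N,
  (fun i => match fintype.split i with inl j => c j | inr j => d j end),
  (fun i => match fintype.split i with inl j => s j | inr j => t j end); split.
  by move=> i; case: (fintype.split i) => j.
rewrite big_split_ord; congr (_ + _); apply: eq_bigr => i _.
  by rewrite (unsplitK (inl i)).
by rewrite (unsplitK (inr i)).
Qed.

Lemma sub_lin_span S x : S x -> lin_span S x.
Proof.
move=> Sx; exists 1%N, (fun=> 1), (fun=> x); split=> //.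
by rewrite big_ord1 scale1r.
Qed.

Lemma lin_span0 S : lin_span S 0.
Proof.
by exists 0%N, (fun=> 0), (fun=> 0); split=> [[]//|]; rewrite big_ord0.
Qed.

End Closure.

Definition bop_one (R : realType) (H : hilbertType R) : boundedop H.
Proof.
apply: (@BoundedOp R H id id) => //.
- by exists 1 => // x; rewrite mul1r.
- by exists 1 => // x; rewrite mul1r.
Defined.

(** * The shift representation *)

Section ShiftRepresentation.
Variables (R : realType) (A : cstarType R) (phi : A -> R[i]).
Hypothesis phi_linear : linear_for *%R phi.
Hypothesis phi_star : forall x, phi (star x) = (phi x)^*.
Hypothesis phi_sq : forall x, 0 <= phi (star x ** x) <= ((nrm x) ^+ 2)%:C.

(** A successor with a partial inverse covers the integers and the naturals at once. *)
Variables (I : choiceType) (succ : I -> I) (pred : I -> option I).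
Hypothesis succK : pcancel succ pred.
Hypothesis predK : ocancel pred succ.

Local Notation E := (finsupp A I).
Implicit Types (f h : E) (i j : I).

Lemma finsuppP f : exists s : seq I, uniq s /\ forall i, i \notin s -> f i = 0.
Proof.
have /asboolP[s fs] := fsvalP f; exists (undup s); split; first exact: undup_uniq.
by move=> i; rewrite mem_undup; exact: fs.
Qed.

Lemma finsuppP2 f h : exists s : seq I,
  [/\ uniq s, forall i, i \notin s -> f i = 0 & forall i, i \notin s -> h i = 0].
Proof.
have [s [_ fs]] := finsuppP f; have [t [_ ht]] := finsuppP h.
exists (undup (s ++ t)); split; first exact: undup_uniq.
- by move=> i; rewrite mem_undup mem_cat negb_or => /andP[/fs].
- by move=> i; rewrite mem_undup mem_cat negb_or => /andP[_ /ht].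
Qed.

Lemma finsupp_eq f h : (forall i, f i = h i) -> f = h.
Proof. by move=> fh; apply: val_inj; apply/funext. Qed.

Lemma fsvalD f h i : (f + h) i = f i + h i. Proof. by []. Qed.
Lemma fsvalZ (c : R[i]) f i : (c *: f) i = c *: f i. Proof. by []. Qed.
Lemma fsvalB f h i : (f - h) i = f i - h i. Proof. by []. Qed.

(** The direct sum over [I] of copies of the GNS form of [phi]. *)
Definition gsum f h : R[i] := \sum_(i \in [set: I]) phi (star (h i) ** f i).

Lemma functional0 : phi 0 = 0.
Proof. by have := phi_linear (-1) 0 0; rewrite scaler0 addr0 mulN1r addNr. Qed.

Lemma functionalD x y : phi (x + y) = phi x + phi y.
Proof. by have := phi_linear 1 x y; rewrite scale1r mul1r. Qed.

Lemma functionalZ (c : R[i]) x : phi (c *: x) = c * phi x.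
Proof. by have := phi_linear c x 0; rewrite functional0 !addr0. Qed.

Lemma gsumE (s : seq I) f h : uniq s ->
  (forall i, i \notin s -> star (h i) ** f i = 0) ->
  gsum f h = \sum_(i <- s) phi (star (h i) ** f i).
Proof.
move=> us s0; transitivity (\sum_(i \in [set` s]) phi (star (h i) ** f i)).
  apply/esym/fsbig_widen => //.
  by move=> i [_ /= /negP] /s0 ->; rewrite functional0.
by rewrite -fsbig_seq.
Qed.

Fact gsumD f f' h : gsum (f + f') h = gsum f h + gsum f' h.
Proof.
have [s [us _ hs]] := finsuppP2 f h.
have H f1 i : i \notin s -> star (h i) ** (f1 : E) i = 0.
  by move=> /hs ->; rewrite star0 mul0a.
rewrite !(gsumE us) -?big_split; last 3 first; try exact: H.
by apply: eq_bigr => i _; rewrite fsvalD amulDr functionalD.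
Qed.

Fact gsumZ (c : R[i]) f h : gsum (c *: f) h = c * gsum f h.
Proof.
have [s [us _ hs]] := finsuppP2 f h.
have H f1 i : i \notin s -> star (h i) ** (f1 : E) i = 0.
  by move=> /hs ->; rewrite star0 mul0a.
rewrite !(gsumE us); try exact: H.
by rewrite big_distrr; apply: eq_bigr => i _; rewrite fsvalZ amulZr functionalZ.
Qed.

Fact gsumC f h : gsum f h = (gsum h f)^*.
Proof.
have [s [us fs hs]] := finsuppP2 f h.
rewrite !(gsumE us); first last.
- by move=> i /hs ->; rewrite star0 mul0a.
- by move=> i /fs ->; rewrite star0 mul0a.
by rewrite rmorph_sum; apply: eq_bigr => i _; rewrite /= -phi_star starM starK.
Qed.

Fact gsum_ge0 f : 0 <= gsum f f.
Proof.
have [s [us fs]] := finsuppP f.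
rewrite (gsumE us); last by move=> i /fs ->; rewrite star0 mul0a.
by apply: sumr_ge0 => i _; case/andP: (phi_sq (f i)).
Qed.

Definition gform : semiform E := Semiform gsumD gsumZ gsumC gsum_ge0.

Lemma mkfinsupp_subproof (F : I -> A) (s : seq I) :
  (forall i, i \notin s -> F i = 0) -> F \in @finsupp_pred R A I.
Proof. by move=> Fs; apply/asboolP; exists s. Qed.

Definition delta_supp i x j : A := if j == i then x else 0.

Lemma delta_subproof i (x : A) : delta_supp i x \in @finsupp_pred R A I.
Proof.
apply: (@mkfinsupp_subproof _ [:: i]) => j; rewrite inE /delta_supp.
by case: eqP.
Qed.

Definition delta i x : E := Finsupp (delta_subproof i x).

Lemma deltaE i x j : delta i x j = if j == i then x else 0. Proof. by []. Qed.

Lemma fnorm_delta i x : fnorm gform (delta i x) ^+ 2 = nrm (phi (star x ** x)).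
Proof.
rewrite sqr_sqrtr ?nrm_ge0//=; rewrite (@gsumE [:: i])//; last first.
  by move=> j; rewrite inE deltaE => /negPf ->; rewrite mula0.
by rewrite big_seq1 deltaE eqxx.
Qed.

Lemma fnorm_delta_le i x : fnorm gform (delta i x) <= nrm x.
Proof.
rewrite -(@ler_pXn2r _ 2) ?nnegrE ?nrm_ge0 ?fnorm_ge0// fnorm_delta.
have /andP[p0 px] := phi_sq x.
by rewrite -lecR nrmE ger0_norm.
Qed.

Lemma shift_subproof f : (fun i => f (succ i)) \in @finsupp_pred R A I.
Proof.
have [s [_ fs]] := finsuppP f.
apply: (@mkfinsupp_subproof _ (pmap pred s)) => i hi; apply: fs.
apply: contra hi => his; rewrite mem_pmap; apply/mapP.
by exists (succ i).
Qed.

Definition shift f : E := Finsupp (shift_subproof f).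

Lemma unshift_subproof f :
  (fun j => if pred j is Some i then f i else 0) \in @finsupp_pred R A I.
Proof.
have [s [_ fs]] := finsuppP f.
apply: (@mkfinsupp_subproof _ (map succ s)) => j hj.
have := predK j; case: (pred j) => [i /= ji|//].
by apply: fs; apply: contra hj => his; apply/mapP; exists i.
Qed.

Definition unshift f : E := Finsupp (unshift_subproof f).

Lemma shiftE f i : shift f i = f (succ i). Proof. by []. Qed.
Lemma unshiftE f j : unshift f j = if pred j is Some i then f i else 0.
Proof. by []. Qed.

Lemma unshiftK f : shift (unshift f) = f.
Proof. by apply: finsupp_eq => i; rewrite shiftE unshiftE succK. Qed.

Lemma shift_linear : linear shift.
Proof. by move=> c f h; apply: finsupp_eq. Qed.

Lemma unshift_linear : linear unshift.
Proof.
move=> c f h; apply: finsupp_eq => j; rewrite fsvalD fsvalZ !unshiftE.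
by case: (pred j) => [//|]; rewrite scaler0 addr0.
Qed.

Lemma shift_adj f h : gform (shift f) h = gform f (unshift h).
Proof.
have [s [us hs]] := finsuppP h; rewrite /= (gsumE us); last first.
  by move=> i /hs ->; rewrite star0 mul0a.
have us' : uniq (map succ s).
  by rewrite map_inj_uniq//; exact: pcan_inj succK.
rewrite (gsumE us') ?big_map; last first.
  move=> j hj; rewrite unshiftE; have := predK j.
  case: (pred j) => [i /= ji|_]; last by rewrite star0 mul0a.
  rewrite hs ?star0 ?mul0a//; apply: contra hj => his.
  by apply/mapP; exists i.
by apply: eq_bigr => i _; rewrite shiftE unshiftE succK.
Qed.

Lemma fnorm_unshift f : fnorm gform (unshift f) <= 1 * fnorm gform f.
Proof. by rewrite mul1r /fnorm -shift_adj unshiftK. Qed.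

(** The adjoint of an isometry is contractive: apply Cauchy-Schwarz to
    [|shift f|^2 = g f (unshift (shift f))]. *)
Lemma fnorm_shift f : fnorm gform (shift f) <= 1 * fnorm gform f.
Proof.
rewrite mul1r; set n := fnorm gform _.
have [n0|n0] := leP n 0; first by rewrite (le_trans n0)// fnorm_ge0.
rewrite -(ler_pM2r n0) -expr2.
have -> : n ^+ 2 = nrm (gform f (unshift (shift f))).
  by rewrite -shift_adj sqr_sqrtr ?nrm_ge0.
rewrite (le_trans (cauchy_schwarz _ _ _))// ler_wpM2l ?fnorm_ge0//.
by rewrite (le_trans (fnorm_unshift _))// mul1r.
Qed.

Lemma shift_bounded :
  exists2 C : R, 0 <= C & forall f, fnorm gform (shift f) <= C * fnorm gform f.
Proof. by exists 1 => //; exact: fnorm_shift. Qed.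

Lemma unshift_bounded :
  exists2 C : R, 0 <= C & forall f, fnorm gform (unshift f) <= C * fnorm gform f.
Proof. by exists 1 => //; exact: fnorm_unshift. Qed.

Definition shift_op : boundedop (hcompl gform) := hlift
  (Adjointable shift_linear unshift_linear shift_bounded unshift_bounded shift_adj).

Section Pi.
Variable beta : I -> A -> A.
Hypothesis beta_hom : forall i, is_starhom (beta i).
Hypothesis beta_surj : forall i x, exists a, beta i a = x.

Lemma act_subproof a f : (fun i => beta i a ** f i) \in @finsupp_pred R A I.
Proof.
have [s [_ fs]] := finsuppP f.
by apply: (@mkfinsupp_subproof _ s) => i /fs ->; rewrite mula0.
Qed.

Definition act a f : E := Finsupp (act_subproof a f).

Lemma actE a f i : act a f i = beta i a ** f i. Proof. by []. Qed.

Lemma act_linear a : linear (act a).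
Proof.
by move=> c f h; apply: finsupp_eq => i; rewrite actE amulDr amulZr.
Qed.

Lemma actD a b f : act (a + b) f = act a f + act b f.
Proof.
apply: finsupp_eq => i; rewrite fsvalD !actE -amulDl.
by have := starhom_linear (beta_hom i) 1 a b; rewrite !scale1r => ->.
Qed.

Lemma actZ (c : R[i]) a f : act (c *: a) f = c *: act a f.
Proof.
apply: finsupp_eq => i; rewrite fsvalZ !actE -amulZl.
have l := starhom_linear (beta_hom i).
have b0 : beta i 0 = 0 by have := l (-1) 0 0; rewrite scaler0 addr0 scaleN1r addNr.
by have := l c a 0; rewrite b0 !addr0 => ->.
Qed.

Lemma actM a b f : act (a ** b) f = act a (act b f).
Proof.
by apply: finsupp_eq => i; rewrite !actE (starhomM (beta_hom i)) amulA.
Qed.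

Lemma act_adj a f h : gform (act a f) h = gform f (act (star a) h).
Proof.
have [s [us hs]] := finsuppP h; rewrite /= !(gsumE us); first last.
- by move=> i /hs ->; rewrite star0 mul0a.
- by move=> i /hs hi; rewrite actE hi mula0 star0 mul0a.
apply: eq_bigr => i _; rewrite !actE (starhom_star (beta_hom i)).
by rewrite starM starK amulA.
Qed.

Lemma act_bounded a :
  exists2 C : R, 0 <= C & forall f, fnorm gform (act a f) <= C * fnorm gform f.
Proof.
exists (nrm a); first exact: nrm_ge0.
exact: (star_rep_contractive actD actZ actM act_adj).
Qed.

Definition act_op a : boundedop (hcompl gform) := hlift
  (Adjointable (act_linear a) (act_linear (star a)) (act_bounded a)
    (act_bounded (star a)) (act_adj a)).

Lemma act_op_starhom : is_starhom act_op.
Proof.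
split=> [c a b|a b|a]; apply: boundedop_eq => p; apply: hcompl_eq => f.
- rewrite hliftE /= starD starZ actD actZ hfun_antilinear.
  by rewrite conjCK.
- by rewrite hliftE /= starM actM.
- by rewrite hliftE hlift_starE /= starK.
Qed.

Lemma act_op_inj a f : bop (act_op a) (hinj gform f) = hinj gform (act a f).
Proof. exact: hlift_inj. Qed.

Hypothesis approx : forall (x : A) (d : R), 0 < d -> exists a, nrm (x - a ** x) <= d.

(** Surjectivity of [beta i] lets an approximate unit for [x] act in the summand [i]. Induction on
    the support reaches all of [E], which is dense. *)
Lemma act_op_nondegenerate : nondegenerate_rep act_op.
Proof.
split; first exact: act_op_starhom.
set L := lin_span _; apply/seteqP; split=> // p _.
pose D (q : hcompl gform) := forall e : R, 0 < e -> exists2 y, L y & nrm (q - y) <= e.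
have DD q r : D q -> D r -> D (q + r).
  move=> Dq Dr e e0; have e2 : 0 < e / 2 by lra.
  have [y Ly yq] := Dq _ e2; have [z Lz zr] := Dr _ e2.
  exists (y + z); first exact: lin_spanD.
  by rewrite opprD addrACA (le_trans (nrmD _ _))//; lra.
have D0 : D 0.
  move=> e e0; exists 0; first exact: lin_span0.
  by rewrite subrr nrm0 ltW.
have Ddelta i x : D (hinj gform (delta i x)).
  move=> e e0; have [a' ha'] := approx x e0; have [a ha] := beta_surj i a'.
  exists (bop (act_op a) (hinj gform (delta i x))).
    by apply: sub_lin_span; exists a => //; exists (hinj gform (delta i x)).
  rewrite act_op_inj -hinjB nrm_hinj.
  have -> : delta i x - act a (delta i x) = delta i (x - a' ** x).
    apply: finsupp_eq => j; rewrite fsvalB actE !deltaE.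
    by case: eqP => [->|_]; rewrite ?ha// mula0 subrr.
  by rewrite (le_trans (fnorm_delta_le _ _)).
have Dinj f : D (hinj gform f).
  have [s [_]] := finsuppP f; elim: s f => [|i s IH] f fs.
    have -> : f = 0 by apply: finsupp_eq => i; rewrite fs.
    by rewrite -(scale0r (0 : E)) hinjZ scale0r.
  have -> : f = delta i (f i) + (f - delta i (f i)) by rewrite addrC subrK.
  rewrite hinjD; apply: DD => //; apply: IH => j js.
  rewrite fsvalB deltaE; case: eqP => [->|/eqP ji]; first by rewrite subrr.
  by rewrite subr0 fs// inE negb_or ji.
apply: closure_nrm => e e0; have e2 : 0 < e / 2 by lra.
have [f pf] := hinj_dense p e2; have [y Ly fy] := Dinj f _ e2.
by exists y => //; have := nrm_tri p (hinj gform f) y; lra.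
Qed.

Variable alpha : A -> A.
Hypothesis alpha_star : forall a, alpha (star a) = star (alpha a).
Hypothesis beta_succ : forall i a, beta (succ i) a = beta i (alpha a).

Let H := hcompl gform.
Let one := bop_one H.
Let one_mul (T : boundedop H) : one ** T = T.
Proof. exact: boundedop_eq. Qed.
Let mul_one (T : boundedop H) : T ** one = T.
Proof. exact: boundedop_eq. Qed.

Let shift_coisometry : shift_op ** star shift_op = one.
Proof.
apply: boundedop_eq => p; apply: hcompl_eq => f.
by change (p (shift (unshift f)) = p f); rewrite unshiftK.
Qed.

Let shift_intertwine a : act_op (alpha a) ** shift_op = shift_op ** act_op a.
Proof.
apply: boundedop_eq => p; apply: hcompl_eq => f.
change (p (unshift (act (star (alpha a)) f)) = p (act (star a) (unshift f))).
congr (p _).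
apply: finsupp_eq => j; rewrite unshiftE !actE unshiftE.
have := predK j; case: (pred j) => [i /= <-|_]; last by rewrite mula0.
by rewrite beta_succ alpha_star.
Qed.

Definition shift_powers := powers one shift_op.

Lemma shift_covariant_rep : covariant_rep alpha act_op shift_powers.
Proof.
have pi_star a : act_op (star a) = star (act_op a).
  exact: starhom_star act_op_starhom a.
split.
- exact: act_op_nondegenerate.
- exact: powers_piso one_mul mul_one shift_coisometry.
- exact: powers_covariant one_mul mul_one alpha_star pi_star shift_coisometry
    shift_intertwine.
Qed.

Lemma shift_powers1 : shift_powers 1 = shift_op.
Proof. exact: mul_one. Qed.

Lemma shift_unitary a : (forall i, pred i <> None) ->
  star shift_op ** shift_op ** act_op a = act_op a.
Proof.
move=> predT; rewrite (_ : star shift_op ** shift_op = one) ?one_mul//.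
apply: boundedop_eq => p; apply: hcompl_eq => f.
change (p (unshift (shift f)) = p f); congr (p _).
apply: finsupp_eq => j; rewrite unshiftE.
by have := predK j; have := predT j; case: (pred j) => [i _ /= <-|].
Qed.

Variables (i0 : I) (a x : A).
Hypothesis beta_i0 : beta i0 a = a.
Hypothesis phi_ax : phi (star (a ** x) ** (a ** x)) != 0.

Let hinj_ax : hinj gform (act a (delta i0 x)) != 0.
Proof.
rewrite -nrm_eq0 nrm_hinj -sqrf_eq0.
have -> : act a (delta i0 x) = delta i0 (a ** x).
  apply: finsupp_eq => j; rewrite actE !deltaE.
  by case: eqP => [->|_]; rewrite ?beta_i0// mula0.
by rewrite fnorm_delta nrm_eq0.
Qed.

Lemma act_op_neq0 : act_op a <> 0.
Proof.
move=> pa0; move: hinj_ax; rewrite -act_op_inj pa0 /=.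
by rewrite eqxx.
Qed.

(** As [i0] is not a successor, the shift kills the vector given by [delta i0 (a ** x)], which is
    nonzero by [phi_ax]. *)
Lemma shift_not_isometric : pred i0 = None ->
  star shift_op ** shift_op ** act_op a <> act_op a.
Proof.
move=> pi0 E0; move: hinj_ax; rewrite -act_op_inj -E0 => /eqP; apply.
change (bop (star shift_op) (bop shift_op (bop (act_op a) (hinj gform (delta i0 x)))) = 0).
have -> : bop shift_op (bop (act_op a) (hinj gform (delta i0 x))) = 0.
  rewrite act_op_inj hlift_inj /=; apply: hcompl_eq => f.
  rewrite hinjE (_ : shift _ = 0) ?sform0//; apply: finsupp_eq => j.
  rewrite shiftE actE deltaE; case: eqP => [ji|_]; last by rewrite mula0.
  by have := succK j; rewrite ji pi0.
exact: hcompl_eq.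
Qed.

End Pi.
End ShiftRepresentation.

(** * Ideals of the crossed product *)

Section Kernel.
Variables (R : realType) (B : cstarType R) (H : hilbertType R).
Variable rho : B -> boundedop H.
Hypothesis rho_hom : is_starhom rho.

Fact dot_ge0 (x : H) : 0 <= dot x x.
Proof. by rewrite dot_norm exprn_ge0. Qed.

(** The inner product of [H] as a [semiform], so that [star_rep_contractive] applies to [rho]. *)
Definition dot_form : semiform H := Semiform (@dotDl R H) (@dotZl R H) (@dotC R H)
  dot_ge0.

Lemma fnorm_dot_form (x : H) : fnorm dot_form x = nrm x.
Proof.
have -> : fnorm dot_form x = Num.sqrt (nrm x ^+ 2).
  rewrite /fnorm /= dot_norm -nrmE -rmorphXn nrmr ger0_norm//.
  by rewrite sqr_ge0.
by rewrite sqrtr_sqr ger0_norm ?nrm_ge0.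
Qed.

Lemma starhomD a b : rho (a + b) = rho a + rho b.
Proof. by have := starhom_linear rho_hom 1 a b; rewrite !scale1r. Qed.

Lemma starhom0 : rho 0 = 0.
Proof.
by have := starhom_linear rho_hom (-1) 0 0; rewrite scaler0 addr0 scaleN1r addNr.
Qed.

Lemma starhomZ (c : R[i]) a : rho (c *: a) = c *: rho a.
Proof. by have := starhom_linear rho_hom c a 0; rewrite starhom0 !addr0. Qed.

Lemma starhom_contractive b x : nrm (bop (rho b) x) <= nrm b * nrm x.
Proof.
rewrite -!fnorm_dot_form.
apply: (@star_rep_contractive _ _ _ dot_form (fun b => bop (rho b))).
- by move=> a c y; rewrite starhomD.
- by move=> c a y; rewrite starhomZ.
- by move=> a c y; rewrite (starhomM rho_hom).
- by move=> a y z; rewrite (starhom_star rho_hom) /= bop_adjP.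
Qed.

Lemma kernel_closed_ideal : is_closed_ideal [set b | rho b = 0].
Proof.
have mul0 (T : boundedop H) : 0 ** T = 0 by exact: boundedop_eq.
have mulT0 (T : boundedop H) : T ** 0 = 0.
  by have := amulZr 0 T 0; rewrite !scale0r.
split=> /=.
- move=> b cb; apply: boundedop_eq => x /=; apply: nrm0_eq0.
  apply: (@le_epsP _ _ _ (nrm x)) => e e0 _; rewrite add0r mulrC.
  have [c /= c0 bc] := nrm_closure cb e0.
  have -> : rho b = rho (b - c).
    by rewrite -scaleN1r starhomD starhomZ c0 scaler0 addr0.
  by rewrite (le_trans (starhom_contractive _ _))// ler_wpM2r ?nrm_ge0.
- exact: starhom0.
- by move=> x y x0 y0; rewrite starhomD x0 y0 addr0.
- by move=> c x x0; rewrite starhomZ x0 scaler0.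
- by move=> x y y0; rewrite (starhomM rho_hom) y0 mulT0.
- by move=> x y x0; rewrite (starhomM rho_hom) x0 mul0.
Qed.

End Kernel.

Lemma iter_starhom (R : realType) (A : starAlgType R) (f : A -> A) n :
  is_starhom f -> is_starhom (iter n f).
Proof.
move=> [l m s]; elim: n => [|n [ln mn sn]]; first by split.
by split=> [c x y|x y|x]; rewrite !iterS ?ln ?mn ?sn ?l ?m ?s.
Qed.

(** The product of the multiplier [star (v 1) ** v 1] with [jA a] lies in [B], so the extension
    [rhobar] computes the value of [rho] there. *)
Lemma crossed_product_rep (R : realType) (A : cstarType R) (alpha : A -> A)
    (B : cstarType R) (jA : A -> B) (v : nat -> multiplier B) (H : hilbertType R)
    (pi : A -> boundedop H) (V : nat -> boundedop H) :
  is_piso_crossed_product alpha jA v -> covariant_rep alpha pi V ->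
  exists rho : B -> boundedop H, [/\ is_starhom rho,
    forall a, rho (jA a) = pi a &
    forall a, rho (mleft (star (v 1%N) ** v 1%N) (jA a)) =
      star (V 1%N) ** V 1%N ** pi a].
Proof.
move=> hB /(piso_cp_universal hB)[rho [rhobar [[rho_hom _] [bar_hom barE] piE VE]]].
exists rho; split=> // a; rewrite -barE -mult_mul_embed.
by rewrite !(starhomM bar_hom) (starhom_star bar_hom) barE -VE -piE.
Qed.

(** With [f'] inverse to [f] this is the integer power of [f]; [Negz n] stands for [- n.+1], whence
    the exponent. *)
Definition int_iter (T : Type) (f f' : T -> T) (z : int) : T -> T :=
  match z with Posz n => iter n f | Negz n => iter n.+1 f' end.

Lemma int_iter_succ (T : Type) (f f' : T -> T) (z : int) x :
  cancel f f' -> int_iter f f' (z + 1) x = int_iter f f' z (f x).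
Proof.
move=> ff'; case: z => [n|[|n]].
- by rewrite -PoszD addn1 /= -iterS iterSr.
- by rewrite /= ff'.
- have -> : Negz n.+1 + 1 = Negz n.
    by rewrite !NegzE -(addn1 n.+1) PoszD opprD subrK.
  by rewrite /int_iter [in RHS]iterSr ff'.
Qed.

Theorem theorem4p3 (R : realType) (A : cstarType R) (alpha : A -> A)
  (hA : exists a : A, a <> 0) (halpha : is_automorphism alpha)
  (B : cstarType R) (jA : A -> B) (v : nat -> multiplier B)
  (hB : is_piso_crossed_product alpha jA v) :
  ~ simple_cstar B.
Proof.
move=> simpleB; have [alpha_hom [gamma alphaK gammaK]] := halpha.
have alpha_star := starhom_star alpha_hom.
have gamma_hom : is_starhom gamma.
  split=> [c x y|x y|x]; apply: (can_inj alphaK); rewrite gammaK.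
  - by rewrite (starhom_linear alpha_hom) !gammaK.
  - by rewrite (starhomM alpha_hom) !gammaK.
  - by rewrite (starhom_star alpha_hom) !gammaK.
have [phi [phi_lin phi_star phi_sq [a [x phi_ax]]]] := nonzero_state hA.
have approx := approximate_unit hA.
pose pred2 n : option nat := if n is k.+1 then Some k else None.
have pred2K : ocancel pred2 S by case.
have succ2K : pcancel S pred2 by [].
pose beta2 n := iter n alpha.
have beta2_hom n : is_starhom (beta2 n) by exact: iter_starhom.
have beta2_surj n y : exists b, beta2 n b = y.
  exists (iter n gamma y); rewrite /beta2.
  by elim: n y => // n IH y; rewrite iterS iterSr IH gammaK.
have beta2_succ n b : beta2 n.+1 b = beta2 n (alpha b) by rewrite /beta2 iterSr.
have cov2 := shift_covariant_rep phi_lin phi_star phi_sq succ2K pred2K beta2_hom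
  beta2_surj approx alpha_star beta2_succ.
pose succ1 (z : int) := z + 1.
(* Never [None], so the shift over the integers is unitary. *)
pose pred1 (z : int) := Some (z - 1).
have pred1K : ocancel pred1 succ1 by move=> z; rewrite /= /succ1 subrK.
have succ1K : pcancel succ1 pred1 by move=> z; rewrite /pred1 addrK.
pose beta1 := int_iter alpha gamma.
have beta1_hom z : is_starhom (beta1 z) by case: z => n; exact: iter_starhom.
have beta1_surj z y : exists b, beta1 z b = y.
  case: z => n; first exact: (beta2_surj n).
  exists (iter n.+1 alpha y); rewrite /beta1 /int_iter.
  by elim: n.+1 y => // k IH y; rewrite iterS iterSr IH alphaK.
have beta1_succ z b : beta1 (succ1 z) b = beta1 z (alpha b).
  exact: int_iter_succ.
have cov1 := shift_covariant_rep phi_lin phi_star phi_sq succ1K pred1K beta1_hom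
  beta1_surj approx alpha_star beta1_succ.
have [rho1 [hom1 rho1j rho1v]] := crossed_product_rep hB cov1.
have [rho2 [hom2 rho2j rho2v]] := crossed_product_rep hB cov2.
pose d := jA a - mleft (star (v 1%N) ** v 1%N) (jA a).
have rho1d : rho1 d = 0.
  rewrite /d -scaleN1r (starhomD hom1) (starhomZ hom1) rho1v rho1j scaleN1r.
  by rewrite shift_powers1 shift_unitary// subrr.
(* A zero kernel would give [d = 0], which [rho2] refutes; a full kernel would contain [jA a], on
   which [rho1] is nonzero. *)
have [K0|KT] := simpleB _ (kernel_closed_ideal hom1).
  have : [set b | rho1 b = 0] d by [].
  rewrite K0 => /= d0.
  apply: (@shift_not_isometric _ _ _ phi_lin phi_star phi_sq _ _ _ succ2K pred2K
    _ beta2_hom 0%N a x erefl phi_ax erefl).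
  rewrite -rho2j -{2}(subrK (mleft (star (v 1%N) ** v 1%N) (jA a)) (jA a)).
  by rewrite -/d d0 add0r rho2v rho2j shift_powers1.
have : [set: B] (jA a) by [].
rewrite -KT /= rho1j.
exact: (@act_op_neq0 _ _ _ phi_lin phi_star phi_sq _ _ beta1_hom (0 : int) a x
  erefl phi_ax).
Qed.
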